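(* The functor $\mathrm{TG}\colon\mathbf{ISA}\to\mathbf{EG}$, sending an inverse semigroup action $(S,X,\alpha)$ to its transformation groupoid $S\ltimes_\alpha X$ and an action morphism $(\theta,\xi)$ to the couple morphism $[\varphi_\xi,\psi_\theta]$, descends to a functor from the subcategory $\mathbf{ISA_{lcH}}$ to the subcategory $\mathbf{EG_{lcH}}$.
   Context: $\mathbf{ISA}$ and $\mathbf{ISA_{lcH}}$. A partial map $f\colon X\supset D_f\to Y$ is a continuous map from an open subspace $D_f\subset X$ to $Y$; $f^{-1}(V):=\{x\in D_f:f(x)\in V\}$; $f_2\circ f_1$ has domain $f_1^{-1}(D_{f_2})$; $f$ is proper if $f^{-1}(C)$ is compact for every compact $C\subset Y$. An inverse semigroup is a semigroup $S$ in which every $s$ has a unique $s^*$ with $ss^*s=s$, $s^*ss^*=s^*$; $E(S)$ is its set of idempotents. $I(X)$ is the inverse semigroup of homeomorphisms between open subspaces of $X$. An inverse semigroup action $(S,X,\alpha)$ is an inverse semigroup $S$, a topological space $X$ and a semigroup homomorphism $\alpha\colon S\to I(X)$ with $\bigcup_sD^\alpha_s=X$, $D^\alpha_s$ being the domain of $\alpha_s$. An action morphism $(\theta,\xi)\colon(S,X,\alpha)\to(T,Y,\beta)$ is a semigroup homomorphism $\theta\colon S\to T$ and a partial map $\xi\colon Y\supset D_\xi\to X$ with (i) $\xi^{-1}(D^\alpha_s)=D^\beta_{\theta(s)}$ for all $s\in S$; (ii) $\alpha_s(\xi(y))=\xi(\beta_{\theta(s)}(y))$ for all $s\in S$, $y\in\xi^{-1}(D^\alpha_s)$;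 it is proper if $\xi$ is. Composition: $(\theta_2,\xi_2)\cdot(\theta_1,\xi_1)=(\theta_2\circ\theta_1,\xi_1\circ\xi_2)$; identities $(\mathrm{id}_S,\mathrm{id}_X)$. $\mathbf{ISA}$: all actions and action morphisms. $\mathbf{ISA_{lcH}}$: actions on locally compact Hausdorff spaces and proper action morphisms. $\mathbf{EG}$ and $\mathbf{EG_{lcH}}$. A groupoid $G$ has unit space $G^{(0)}\subset G$, domain and range maps $d,r$; $g'g$ is defined iff $d(g')=r(g)$; $G_u:=d^{-1}(u)$. A topological groupoid is étale if $d\colon G\to G^{(0)}$ is a local homeomorphism. For a groupoid homomorphism $\varphi\colon G\to H$, $\varphi^{(0)}$ and $\varphi_u\colon G_u\to H_{\varphi(u)}$ are its restrictions; $\varphi$ is fibrewise bijective if all $\varphi_u$ are bijective. A couple morphism $(\varphi,\psi;K)\colon G\to H$ of étale groupoids consists of an étale groupoid $K$, a continuous fibrewise bijective homomorphism $\varphi\colon K\to G$ and a continuous homomorphism $\psi\colon K\to H$ with $\psi^{(0)}$ open and injective; it is proper if $\varphi^{(0)}$ is proper. Equivalence: a homeomorphic groupoid isomorphism $\iota\colon K_1\to K_2$ with $\varphi_2\circ\iota=\varphi_1$, $\psi_2\circ\iota=\psi_1$; $[\varphi,\psi;K]$ is the class. Composition of $[\varphi_1,\psi_1;K_1]\colon G_1\to G_2$ and $[\varphi_2,\psi_2;K_2]\colon G_2\to G_3$ is $[\varphi_1\circ\widetilde{\varphi_2},\psi_2\circ\widetilde{\psi_1};K_1\times_{G_2}K_2]$,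 with $K_1\times_{G_2}K_2=\{(k_1,k_2):\psi_1(k_1)=\varphi_2(k_2)\}$ (component-wise structure, topology from the product), $\widetilde{\varphi_2}(k_1,k_2)=k_1$, $\widetilde{\psi_1}(k_1,k_2)=k_2$; identities $[\mathrm{id}_G,\mathrm{id}_G;G]$. $\mathbf{EG}$: étale groupoids and classes of couple morphisms. $\mathbf{EG_{lcH}}$: étale groupoids with locally compact Hausdorff unit spaces and proper couple morphisms. The functor $\mathrm{TG}$. $S\ltimes_\alpha X:=\{(s,x)\in S\times X:x\in D^\alpha_s\}/{\sim}$, where $(s,x)\sim(t,y)$ iff $x=y$ and there is $e\in E(S)$ with $x\in D^\alpha_e$ and $se=te$; the unit space $\{[e,x]:e\in E(S)\}$ is identified with $X$ via $[e,x]\mapsto x$; $d([s,x])=x$, $r([s,x])=\alpha_s(x)$, $[t,\alpha_s(x)][s,x]=[ts,x]$, $[s,x]^{-1}=[s^*,\alpha_s(x)]$; the topology is generated by the sets $[s,U]:=\{[s,x]:x\in U\}$, $s\in S$, $U\subset D^\alpha_s$ open. For $(\theta,\xi)\colon(S,X,\alpha)\to(T,Y,\beta)$, let $(S,D_\xi,\beta\theta)$ be the action with $(\beta\theta)_s=\beta_{\theta(s)}$; $\mathrm{TG}(\theta,\xi)=[\varphi_\xi,\psi_\theta;S\ltimes_{\beta\theta}D_\xi]$ with $\varphi_\xi([s,y])=[s,\xi(y)]\in S\ltimes_\alpha X$ and $\psi_\theta([s,y])=[\theta(s),y]\in T\ltimes_\beta Y$. *)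

(* Defs.v *)
From HB Require Import structures.
From mathcomp Require Import all_boot monoid generic_quotient.
From mathcomp Require Import all_classical topology.

Set Implicit Arguments.
Unset Strict Implicit.
Unset Printing Implicit Defensive.

Local Open Scope classical_set_scope.
Local Open Scope group_scope.
Local Open Scope quotient_scope.

(* A partial map [X ⊃ D -> Y] is a function [X -> option Y] whose value is
   [Some _] exactly on [D].  Composition is [pcomp] of ssrfun:
   [pcomp g f x = obind g (f x)], whose domain is [f^-1 (pdom g)]. *)

Definition pdom (T U : Type) (f : T -> option U) : set T := [set x | f x].

Definition ppre (T U : Type) (f : T -> option U) (V : set U) : set T :=
  [set x | exists2 y, f x = Some y & V y].

(* As [pdom f] is open, openness in [pdom f] of the preimages is the same as
   openness in [X]. *)
Definition is_pmap (X Y : topologicalType) (f : X -> option Y) : Prop :=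
  open (pdom f) /\ forall V : set Y, open V -> open (ppre f V).

Definition is_phomeo (X Y : topologicalType) (f : X -> option Y) : Prop :=
  is_pmap f /\ exists2 g : Y -> option X,
    is_pmap g & forall x y, f x = Some y <-> g y = Some x.

Definition proper_pmap (X Y : topologicalType) (f : X -> option Y) : Prop :=
  forall C : set Y, compact C -> compact (ppre f C).

HB.mixin Record Semigroup_isInverse S & Semigroup S := {
  star : S -> S;
  mulg_star : forall s : S, s * star s * s = s /\ star s * s * star s = star s;
  star_uniq : forall s t : S, s * t * s = s /\ t * s * t = t -> t = star s
}.

#[short(type="inverseSemigroupType")]
HB.structure Definition InverseSemigroup :=
  {S of Semigroup_isInverse S & Semigroup S}.

Definition idempotents (S : inverseSemigroupType) : set S :=
  [set e | e * e = e].

Lemma idempotentC (S : inverseSemigroupType) (e f : S) :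
  idempotents e -> idempotents f -> e * f = f * e.
Proof.
rewrite /idempotents /= => He Hf.
have prodI (a b : S) : a * a = a -> b * b = b -> (a * b) * (a * b) = a * b.
  move=> Ha Hb; set c := star (a * b).
  have [H1 H2] := mulg_star (a * b); rewrite -/c in H1 H2.
  have Hc : b * c * a = c.
    apply: star_uniq; split.
      rewrite -[RHS]H1 -!mulgA (mulgA b b) Hb (mulgA a a) Ha !mulgA; done.
    by rewrite -[in RHS]H2 -!mulgA (mulgA a a) Ha (mulgA b b) Hb !mulgA.
  have cI : c * c = c.
    by rewrite -{1}Hc -{2}Hc -[in RHS]Hc -[in RHS]H2 -!mulgA.
  have E1 : a * b = star c by apply: star_uniq; split.
  have E2 : c = star c by apply: star_uniq; rewrite !cI.
  by rewrite E1 -E2.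
have eff : e * f * (f * e) * (e * f) = e * f.
  by rewrite -[RHS](prodI e f He Hf) -!mulgA (mulgA f f) Hf (mulgA e e) He.
have fee : f * e * (e * f) * (f * e) = f * e.
  by rewrite -[RHS](prodI f e Hf He) -!mulgA (mulgA f f) Hf (mulgA e e) He.
have E1 : f * e = star (e * f) by apply: star_uniq; split.
have E2 : e * f = star (e * f) by apply: star_uniq; rewrite !(prodI e f).
by rewrite E1 -E2.
Qed.

Record action := Action {
  asg : inverseSemigroupType;
  asp : topologicalType;
  act : asg -> asp -> option asp;
  act_homeo : forall s, is_phomeo (act s);
  actM : forall s t, act (s * t) =1 pcomp (act s) (act t);
  act_cover : forall x, exists s, pdom (act s) x
}.

Arguments act : clear implicits.

Section action_theory.
Variable A : action.
Implicit Types (s t e : asg A) (x y : asp A).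

Lemma act_inj s x x' y :
  act A s x = Some y -> act A s x' = Some y -> x = x'.
Proof.
by have [_ [g _ gP]] := act_homeo s; move=> /gP gx /gP; rewrite gx => -[].
Qed.

Lemma act_star s x y : act A s x = Some y <-> act A (star s) y = Some x.
Proof.
have step t u : t * u * t = t -> forall a b,
    act A t a = Some b -> act A u b = Some a.
  move=> tut a b ta; have := actM (t * u) t a.
  rewrite tut /pcomp ta /= actM /pcomp.
  case E : (act A u b) => [c|//] /= /esym tc.
  by rewrite (act_inj ta tc).
have [H1 H2] := mulg_star s; split; first exact: step.
exact: step.
Qed.

Lemma act_idempotent e x :
  idempotents e -> pdom (act A e) x -> act A e x = Some x.
Proof.
rewrite /idempotents /pdom /= => eI; case E : (act A e x) => [y|//] _.
have := actM e e x; rewrite eI /pcomp E /= => /esym E'.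
by rewrite -(act_inj E E').
Qed.

End action_theory.

Record action_mor (A B : action) := ActionMor {
  theta : {multiplicative asg A -> asg B};
  xi : asp B -> option (asp A);
  xi_pmap : is_pmap xi;
  xi_dom : forall s, ppre xi (pdom (act A s)) = pdom (act B (theta s));
  xi_equiv : forall s y, ppre xi (pdom (act A s)) y ->
    pcomp (act A s) xi y = pcomp xi (act B (theta s)) y
}.

Lemma ppre_comp (T U V : Type) (f : T -> option U) (g : U -> option V) C :
  ppre (pcomp g f) C = ppre f (ppre g C).
Proof.
apply/seteqP; split=> x; rewrite /ppre /pcomp /=.
  by case: (f x) => [y|] [z] //= gy Cz; exists y => //; exists z.
by move=> [y -> [z gy Cz]] /=; exists z.
Qed.

Lemma ppreT (T U : Type) (f : T -> option U) : ppre f setT = pdom f.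
Proof.
apply/seteqP; split=> x; rewrite /ppre /pdom /=; first by move=> [y ->].
by case: (f x) => [y|] //= _; exists y.
Qed.

Lemma is_pmap_comp (X Y Z : topologicalType) (f : X -> option Y)
  (g : Y -> option Z) : is_pmap f -> is_pmap g -> is_pmap (pcomp g f).
Proof.
move=> [_ fc] [_ gc]; have H V : open V -> open (ppre (pcomp g f) V).
  by move=> Vo; rewrite ppre_comp; apply/fc/gc.
by split=> //; rewrite -ppreT; apply: H; exact: openT.
Qed.

Lemma ppre_some (T : Type) (C : set T) : ppre some C = C.
Proof.
by apply/seteqP; split=> x; [move=> [y [<-]]|move=> Cx; exists x].
Qed.

Lemma is_pmap_some (X : topologicalType) : is_pmap (@Some X).
Proof.
have H V : open V -> open (ppre (@Some X) V) by rewrite ppre_some.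
by split=> //; rewrite -ppreT; apply: H; exact: openT.
Qed.

Lemma xi_equiv_some (A : action) s y : ppre Some (pdom (act A s)) y ->
  pcomp (act A s) Some y = pcomp Some (act A (idfun s)) y.
Proof. by rewrite /pcomp /=; case: (act A s y). Qed.

Definition action_id (A : action) : action_mor A A :=
  @ActionMor A A idfun Some (is_pmap_some (asp A))
    (fun s => ppre_some (pdom (act A s))) (@xi_equiv_some A).

Section action_comp.
Variables (A B C : action) (g : action_mor B C) (f : action_mor A B).

Lemma xi_dom_comp s : ppre (pcomp (xi f) (xi g)) (pdom (act A s)) =
  pdom (act C ((theta g \o theta f) s)).
Proof. by rewrite ppre_comp xi_dom xi_dom. Qed.

Lemma xi_equiv_comp s y : ppre (pcomp (xi f) (xi g)) (pdom (act A s)) y ->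
  pcomp (act A s) (pcomp (xi f) (xi g)) y =
  pcomp (pcomp (xi f) (xi g)) (act C ((theta g \o theta f) s)) y.
Proof.
rewrite ppre_comp => -[z gy fz].
have fE := xi_equiv fz; rewrite xi_dom in fz.
have /xi_equiv gE : ppre (xi g) (pdom (act B (theta f s))) y by exists z.
move: fE gE; rewrite /pcomp gy /= => -> ->.
by case: (act C _ y).
Qed.

Definition action_comp : action_mor A C :=
  @ActionMor A C (theta g \o theta f) (pcomp (xi f) (xi g))
    (is_pmap_comp (xi_pmap g) (xi_pmap f)) xi_dom_comp xi_equiv_comp.

End action_comp.

(* The action [(S, D_xi, beta theta)] of a morphism [(theta, xi)]. *)

Section action_res.
Variables (A B : action) (f : action_mor A B).

Let D : set (asp B) := pdom (xi f).

Definition res_act (s : asg A) (y : D) : option D :=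
  obind insub (act B (theta f s) (val y)).

Lemma theta_star s : theta f (star s) = star (theta f s).
Proof.
have [H1 H2] := mulg_star s.
by apply: star_uniq; rewrite -!gmulfM H1 H2.
Qed.

Lemma pdom_theta s y : pdom (act B (theta f s)) y -> y \in D.
Proof.
rewrite -xi_dom => -[x xiy _]; rewrite in_setE.
by rewrite /D /pdom /= xiy.
Qed.

Lemma res_actE s (y z : D) :
  res_act s y = Some z <-> act B (theta f s) (val y) = Some (val z).
Proof.
rewrite /res_act; split; last by move=> -> /=; rewrite valK.
case: (act B _ _) => [z'|//] /=.
by case: insubP => //= u _ <- [<-].
Qed.

Lemma res_act_some s (y : D) z' : act B (theta f s) (val y) = Some z' ->
  exists2 z : D, val z = z' & res_act s y = Some z.
Proof.
move=> E; have z'D : z' \in D.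
  move/act_star: E => E; apply: (@pdom_theta (star s)).
  by rewrite theta_star /pdom /= E.
by exists (Sub z' z'D) => //; apply/res_actE.
Qed.

Lemma res_act_ppre s (W : set (asp B)) :
  ppre (res_act s) (set_val @^-1` W) =
  set_val @^-1` (ppre (act B (theta f s)) W).
Proof.
apply/seteqP; split=> y /=.
  by move=> [z /res_actE E Wz]; exists (val z).
by move=> [z' /res_act_some[z <- E] Wz]; exists z.
Qed.

Lemma res_act_pmap s : is_pmap (res_act s).
Proof.
have H V : open V -> open (ppre (res_act s) V).
  move=> [W oW <-]; rewrite res_act_ppre.
  exists (ppre (act B (theta f s)) W) => //.
  by have [[_ +] _] := act_homeo (theta f s); apply.
by split=> //; rewrite -ppreT; apply: H; exact: openT.
Qed.

Lemma res_act_homeo s : is_phomeo (res_act s).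
Proof.
split; first exact: res_act_pmap.
exists (res_act (star s)); first exact: res_act_pmap.
move=> x y; split=> /res_actE E; apply/res_actE.
  by rewrite theta_star; exact: (act_star _ _ _).1.
by apply: (act_star _ _ _).2; rewrite -theta_star.
Qed.

Lemma res_actM s t : res_act (s * t) =1 pcomp (res_act s) (res_act t).
Proof.
move=> y; rewrite /pcomp {1}/res_act gmulfM actM /pcomp.
case E : (act B (theta f t) (val y)) => [z'|] /=; last by rewrite /res_act E.
by have [z <- ->] := res_act_some E.
Qed.

Lemma res_act_cover (y : D) : exists s, pdom (res_act s) y.
Proof.
have := set_mem (valP y); rewrite /D /pdom /=.
case E : (xi f (val y)) => [x|] // _.
have [s sx] := act_cover x; exists s.
have : pdom (act B (theta f s)) (val y) by rewrite -xi_dom; exists x.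
rewrite /pdom /=; case E' : (act B _ _) => [z'|] // _.
by have [z _ ->] := res_act_some E'.
Qed.

Definition action_res : action :=
  @Action (asg A) D res_act res_act_homeo res_actM res_act_cover.

End action_res.

(* The bare structure, without axioms: [gmul g' g] is only meaningful when
   [gd g' = gr g]. *)

Record pregroupoid := Pregroupoid {
  garr :> topologicalType;
  gunit : set garr;
  gd : garr -> garr;
  gr : garr -> garr;
  gmul : garr -> garr -> garr;
  ginv : garr -> garr
}.

Arguments gunit : clear implicits.
Arguments gd {G} : rename.
Arguments gr {G} : rename.
Arguments gmul {G} : rename.
Arguments ginv {G} : rename.

Definition composable (G : pregroupoid) : set (G * G) :=
  [set p | gd p.1 = gr p.2].

Record is_groupoid (G : pregroupoid) : Prop := IsGroupoid {
  gd_unit : forall g : G, gunit G (gd g);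
  gr_unit : forall g : G, gunit G (gr g);
  gd_id : forall u : G, gunit G u -> gd u = u;
  gr_id : forall u : G, gunit G u -> gr u = u;
  gd_mul : forall h g : G, gd h = gr g -> gd (gmul h g) = gd g;
  gr_mul : forall h g : G, gd h = gr g -> gr (gmul h g) = gr h;
  gmulA : forall k h g : G, gd k = gr h -> gd h = gr g ->
    gmul k (gmul h g) = gmul (gmul k h) g;
  gmul_gd : forall g : G, gmul g (gd g) = g;
  gmul_gr : forall g : G, gmul (gr g) g = g;
  gd_inv : forall g : G, gd (ginv g) = gr g;
  gr_inv : forall g : G, gr (ginv g) = gd g;
  gmulV : forall g : G, gmul (ginv g) g = gd g;
  gmulVr : forall g : G, gmul g (ginv g) = gr g
}.

Definition open_in (T : topologicalType) (B A : set T) : Prop :=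
  exists2 W, open W & A = B `&` W.

(* [f] is a local homeomorphism from [T] to the subspace [B] of [U]. *)
Definition local_homeo_to (T U : topologicalType) (B : set U) (f : T -> U) :=
  (forall x, B (f x)) /\
  forall x, exists2 V, open_nbhs x V &
    [/\ set_inj V f, {within V, continuous f} &
        forall W, open W -> W `<=` V -> open_in B (f @` W)].

Record is_etale (G : pregroupoid) : Prop := IsEtale {
  etale_groupoid : is_groupoid G;
  gd_continuous : continuous (@gd G);
  gr_continuous : continuous (@gr G);
  ginv_continuous : continuous (@ginv G);
  gmul_continuous :
    {within @composable G, continuous (fun p : G * G => gmul p.1 p.2)};
  gd_local_homeo : local_homeo_to (gunit G) (@gd G)
}.

Record is_ghom (G H : pregroupoid) (f : G -> H) : Prop := IsGhom {
  ghom_unit : forall u, gunit G u -> gunit H (f u);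
  ghom_d : forall g, f (gd g) = gd (f g);
  ghom_r : forall g, f (gr g) = gr (f g);
  ghom_mul : forall h g, gd h = gr g -> f (gmul h g) = gmul (f h) (f g)
}.

Definition gfibre (G : pregroupoid) (u : G) : set G := [set g | gd g = u].

Definition fibrewise_bijective (G H : pregroupoid) (f : G -> H) : Prop :=
  forall u, gunit G u -> set_bij (gfibre u) (gfibre (f u)) f.

Record couple (G H : pregroupoid) := Couple {
  cK : pregroupoid;
  cphi : cK -> G;
  cpsi : cK -> H
}.

Arguments cK {G H}.
Arguments cphi {G H}.
Arguments cpsi {G H}.

Record is_couple (G H : pregroupoid) (c : couple G H) : Prop := IsCouple {
  couple_etale : is_etale (cK c);
  couple_phi_hom : is_ghom (cphi c);
  couple_phi_continuous : continuous (cphi c);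
  couple_phi_bij : fibrewise_bijective (cphi c);
  couple_psi_hom : is_ghom (cpsi c);
  couple_psi_continuous : continuous (cpsi c);
  couple_psi_inj : set_inj (gunit (cK c)) (cpsi c);
  couple_psi_open : forall W : set (cK c),
    open_in (gunit (cK c)) W -> open_in (gunit H) (cpsi c @` W)
}.

Definition proper_couple (G H : pregroupoid) (c : couple G H) : Prop :=
  forall C : set G, C `<=` gunit G -> compact C ->
    compact (gunit (cK c) `&` cphi c @^-1` C).

(* [c1] and [c2] define the same class [[phi, psi; K]]. *)
Definition couple_eq (G H : pregroupoid) (c1 c2 : couple G H) : Prop :=
  exists (i : cK c1 -> cK c2) (j : cK c2 -> cK c1),
    [/\ cancel i j, cancel j i, continuous i & continuous j] /\
    [/\ is_ghom i, cphi c2 \o i =1 cphi c1 & cpsi c2 \o i =1 cpsi c1].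

Definition couple_id (G : pregroupoid) : couple G G := @Couple G G G id id.

(* The operations are component-wise.  For homomorphisms [psi] and [phi] the
   result is again in the fibre product (for [gmul], on composable pairs), so
   that the default value of [insubd] is not used. *)
Definition fibre_product (K1 K2 G : pregroupoid)
    (psi : K1 -> G) (phi : K2 -> G) : pregroupoid :=
  let P : set (K1 * K2) := [set p | psi p.1 = phi p.2] in
  @Pregroupoid (set_type P)
    [set p | gunit K1 (val p).1 /\ gunit K2 (val p).2]
    (fun p => insubd p (gd (val p).1, gd (val p).2))
    (fun p => insubd p (gr (val p).1, gr (val p).2))
    (fun q p => insubd p (gmul (val q).1 (val p).1, gmul (val q).2 (val p).2))
    (fun p => insubd p (ginv (val p).1, ginv (val p).2)).

Definition couple_comp (G1 G2 G3 : pregroupoid)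
    (c2 : couple G2 G3) (c1 : couple G1 G2) : couple G1 G3 :=
  @Couple G1 G3 (fibre_product (cpsi c1) (cphi c2))
    (fun p => cphi c1 (val p).1) (fun p => cpsi c2 (val p).2).

Section germs.
Variable A : action.

Definition germ_pair : Type :=
  set_type [set p : asg A * asp A | pdom (act A p.1) p.2].

HB.instance Definition _ := Choice.on germ_pair.

Definition germ_rel (p q : germ_pair) : bool :=
  `[< (val p).2 = (val q).2 /\ exists e, [/\ idempotents e,
        pdom (act A e) (val p).2 & (val p).1 * e = (val q).1 * e] >].

Lemma germ_rel_refl : reflexive germ_rel.
Proof.
move=> [[s x] sxP]; apply/asboolP; split=> //=; exists (star s * s); split=> //.
  by rewrite /idempotents /= mulgA (mulg_star s).2.
have := set_mem sxP; rewrite /pdom /= actM /pcomp.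
by case E : (act A s x) => [y|] //= _; rewrite (proj1 (act_star s x y) E).
Qed.

Lemma germ_rel_sym : symmetric germ_rel.
Proof.
have H p q : germ_rel p q -> germ_rel q p.
  move=> /asboolP[E [e [eI De Ee]]]; apply/asboolP; split=> //.
  by exists e; split=> //; rewrite -E.
by move=> p q; apply/idP/idP; exact: H.
Qed.

Lemma germ_rel_trans : transitive germ_rel.
Proof.
move=> q p u /asboolP[E [e [eI De Ee]]] /asboolP[E' [e' [eI' De' Ee']]].
apply/asboolP; split; first by rewrite E.
rewrite -E in De'; exists (e * e'); split.
- rewrite /idempotents /= -mulgA (mulgA e') -(idempotentC eI eI') -mulgA eI'.
  by rewrite mulgA eI.
- rewrite /pdom /= actM /pcomp (act_idempotent eI' De') /=.
  by rewrite (act_idempotent eI De).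
by rewrite mulgA Ee -mulgA (idempotentC eI eI') mulgA Ee' mulgA.
Qed.

Canonical germ_equiv :=
  EquivRel germ_rel germ_rel_refl germ_rel_sym germ_rel_trans.

Definition germ : Type := {eq_quot germ_rel}.

HB.instance Definition _ := Choice.on germ.

(* [is_germ g s x] : [x] is in the domain of [alpha_s] and [g = [s, x]]. *)
Definition is_germ (g : germ) (s : asg A) (x : asp A) : Prop :=
  exists2 p : germ_pair, val p = (s, x) & g = \pi_({eq_quot germ_rel}) p.

Lemma is_germ_ex g : exists s x, pdom (act A s) x /\ is_germ g s x.
Proof.
have -> : g = \pi_({eq_quot germ_rel}) (repr g) by rewrite reprK.
case: (repr g) => [[s x] sxP]; exists s, x; split; first exact: (set_mem sxP).
by exists (exist _ (s, x) sxP).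
Qed.

Lemma germ_ex s x : pdom (act A s) x -> exists g, is_germ g s x.
Proof.
move=> Dx.
pose p : germ_pair := exist _ (s, x) (mem_set (Dx : [set p | _] (s, x))).
by exists (\pi_({eq_quot germ_rel}) p); exists p.
Qed.

Definition germ_open (s : asg A) (U : set (asp A)) : set germ :=
  [set g | exists2 x, U x & is_germ g s x].

HB.instance Definition _ := @isSubBaseTopological.Build germ (set germ)
  [set V | exists s U,
     [/\ open U, U `<=` pdom (act A s) & V = germ_open s U]] id.

(* [x] in [X] is identified with the unit [[e, x]].  [xget g P] is the element
   of [P] when there is one; the default value [g] is not used in [germ_d],
   [germ_r], [germ_inv], and only for non-composable pairs in [germ_mul]. *)
Definition is_unit_germ (u : germ) (x : asp A) : Prop :=
  exists2 e, idempotents e & is_germ u e x.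

Definition germ_d (g : germ) : germ :=
  xget g [set u | exists s x, is_germ g s x /\ is_unit_germ u x].

Definition germ_r (g : germ) : germ :=
  xget g [set u | exists s x y,
    [/\ is_germ g s x, act A s x = Some y & is_unit_germ u y]].

Definition germ_mul (h g : germ) : germ :=
  xget g [set k | exists t s x y,
    [/\ is_germ g s x, act A s x = Some y, is_germ h t y &
        is_germ k (t * s) x]].

Definition germ_inv (g : germ) : germ :=
  xget g [set k | exists s x y,
    [/\ is_germ g s x, act A s x = Some y & is_germ k (star s) y]].

Definition transformation_groupoid : pregroupoid :=
  @Pregroupoid germ [set u | exists x, is_unit_germ u x]
    germ_d germ_r germ_mul germ_inv.

End germs.

Section TG_hom.
Variables (A B : action) (f : action_mor A B).

Let K : action := action_res f.

Lemma TG_phi_ex (g : germ K) : exists h : germ A,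
  exists s (y : pdom (xi f)) x,
    [/\ is_germ g s y, xi f (val y) = Some x & is_germ h s x].
Proof.
have [s [y []]] := is_germ_ex g; rewrite {1}/pdom /=.
case E : (@res_act _ _ f s y) => [z|] // _ gE; move/res_actE: E => E.
have : pdom (act B (theta f s)) (val y) by rewrite /pdom /= E.
rewrite -xi_dom => -[x xiy /germ_ex[h hE]].
by exists h, s, y, x.
Qed.

Definition TG_phi (g : germ K) : germ A := projT1 (cid (TG_phi_ex g)).

Lemma TG_psi_ex (g : germ K) : exists h : germ B,
  exists s (y : pdom (xi f)), is_germ g s y /\ is_germ h (theta f s) (val y).
Proof.
have [s [y []]] := is_germ_ex g; rewrite {1}/pdom /=.
case E : (@res_act _ _ f s y) => [z|] // _ gE; move/res_actE: E => E.
have /germ_ex[h hE] : pdom (act B (theta f s)) (val y) by rewrite /pdom /= E.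
by exists h, s, y.
Qed.

Definition TG_psi (g : germ K) : germ B := projT1 (cid (TG_psi_ex g)).

Definition TG_couple :
    couple (transformation_groupoid A) (transformation_groupoid B) :=
  @Couple (transformation_groupoid A) (transformation_groupoid B)
    (transformation_groupoid K) TG_phi TG_psi.

End TG_hom.

(* A [category_class] selects objects and arrows in a [category_data]; the
   category consists of what is selected, modulo the relation [hom_eq]. *)

Record category_data := CategoryData {
  ob : Type;
  hom : ob -> ob -> Type;
  hom_eq : forall a b, hom a b -> hom a b -> Prop;
  idm : forall a, hom a a;
  comp : forall a b c, hom b c -> hom a b -> hom a c
}.

Arguments hom {C} : rename.
Arguments hom_eq {C a b} : rename.
Arguments idm {C} : rename.
Arguments comp {C a b c} : rename.

Record category_class (C : category_data) := CategoryClass {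
  in_ob : ob C -> Prop;
  in_hom : forall a b : ob C, hom a b -> Prop
}.

Arguments in_ob {C}.
Arguments in_hom {C} P {a b} : rename.

Definition arrow (C : category_data) (P : category_class C) (a b : ob C)
    (f : hom a b) : Prop :=
  [/\ in_ob P a, in_ob P b & in_hom P f].

Arguments arrow {C} P {a b}.

Record is_category (C : category_data) (P : category_class C) : Prop :=
  IsCategory {
  idm_arrow : forall a : ob C, in_ob P a -> arrow P (idm a);
  comp_arrow : forall (a b c : ob C) (g : hom b c) (f : hom a b),
    arrow P g -> arrow P f -> arrow P (comp g f);
  hom_eq_refl : forall (a b : ob C) (f : hom a b), arrow P f -> hom_eq f f;
  hom_eq_sym : forall (a b : ob C) (f f' : hom a b),
    arrow P f -> arrow P f' -> hom_eq f f' -> hom_eq f' f;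
  hom_eq_trans : forall (a b : ob C) (f f' f'' : hom a b),
    arrow P f -> arrow P f' -> arrow P f'' ->
    hom_eq f f' -> hom_eq f' f'' -> hom_eq f f'';
  comp_eq : forall (a b c : ob C) (g g' : hom b c) (f f' : hom a b),
    arrow P g -> arrow P g' -> arrow P f -> arrow P f' ->
    hom_eq g g' -> hom_eq f f' -> hom_eq (comp g f) (comp g' f');
  comp_idl : forall (a b : ob C) (f : hom a b),
    arrow P f -> hom_eq (comp (idm b) f) f;
  comp_idr : forall (a b : ob C) (f : hom a b),
    arrow P f -> hom_eq (comp f (idm a)) f;
  compA : forall (a b c e : ob C)
      (h : hom c e) (g : hom b c) (f : hom a b),
    arrow P h -> arrow P g -> arrow P f ->
    hom_eq (comp h (comp g f)) (comp (comp h g) f)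
}.

Record is_subcategory (C : category_data) (Q P : category_class C) : Prop :=
  IsSubcategory {
  sub_category : is_category Q;
  super_category : is_category P;
  sub_ob : forall a : ob C, in_ob Q a -> in_ob P a;
  sub_hom : forall (a b : ob C) (f : hom a b), arrow Q f -> arrow P f
}.

Record functor_data (C D : category_data) := FunctorData {
  fob : ob C -> ob D;
  fhom : forall a b : ob C, hom a b -> hom (fob a) (fob b)
}.

Arguments fob {C D}.
Arguments fhom {C D} F {a b} : rename.

Record is_functor (C D : category_data) (P : category_class C)
    (Q : category_class D) (F : functor_data C D) : Prop := IsFunctor {
  fob_in : forall a : ob C, in_ob P a -> in_ob Q (fob F a);
  fhom_in : forall (a b : ob C) (f : hom a b),
    arrow P f -> arrow Q (fhom F f);
  fhom_eq : forall (a b : ob C) (f f' : hom a b), arrow P f -> arrow P f' ->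
    hom_eq f f' -> hom_eq (fhom F f) (fhom F f');
  fhom_id : forall a : ob C, in_ob P a -> hom_eq (fhom F (idm a)) (idm (fob F a));
  fhom_comp : forall (a b c : ob C) (g : hom b c) (f : hom a b),
    arrow P g -> arrow P f ->
    hom_eq (fhom F (comp g f)) (comp (fhom F g) (fhom F f))
}.

Definition action_eq (A B : action) (f f' : action_mor A B) : Prop :=
  theta f =1 theta f' /\ xi f =1 xi f'.

Definition action_data : category_data :=
  @CategoryData action action_mor action_eq action_id action_comp.

Definition groupoid_data : category_data :=
  @CategoryData pregroupoid couple couple_eq couple_id couple_comp.

Definition lcH (X : topologicalType) : Prop :=
  locally_compact [set: X] /\ hausdorff_space X.

Definition ISA : category_class action_data :=
  @CategoryClass action_data (fun=> True) (fun _ _ _ => True).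

Definition ISA_lcH : category_class action_data :=
  @CategoryClass action_data (fun A : action => lcH (asp A))
    (fun (A B : action) (f : action_mor A B) => proper_pmap (xi f)).

Definition EG : category_class groupoid_data :=
  @CategoryClass groupoid_data is_etale is_couple.

Definition EG_lcH : category_class groupoid_data :=
  @CategoryClass groupoid_data
    (fun G : pregroupoid => is_etale G /\ lcH (set_type (gunit G)))
    (fun (G H : pregroupoid) (c : couple G H) =>
      is_couple c /\ proper_couple c).

Definition TG : functor_data action_data groupoid_data :=
  @FunctorData action_data groupoid_data transformation_groupoid TG_couple.

(* Main.v *)
Require Import Defs.
From mathcomp Require Import all_boot monoid generic_quotient finmap.
From mathcomp Require Import all_classical topology.

Set Implicit Arguments.
Unset Strict Implicit.
Unset Printing Implicit Defensive.

Local Open Scope classical_set_scope.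
Local Open Scope group_scope.
Local Open Scope quotient_scope.

(** A couple [phi : K -> G], [psi : K -> H] is determined up to equivalence by
its graph, the relation of all [(phi k, psi k)] in [G x H] ([couple_eqP]).
Since [psi] is injective on units and [phi] is bijective on fibres, the map
[k |-> (phi k, psi k)] is injective; since moreover [psi] is open on units and
all the domain maps are local homeomorphisms, it is a homeomorphism onto its
image ([couple_embedding]).  Hence two couples with the same graph are both
copies of one subspace of [G x H], and the comparison bijection is
automatically a continuous groupoid homomorphism.

The graph of a composite is the composite of the graphs, and the graph of an
identity is the equality.  So once identities and composites are known to be
couples, the category laws, and the compatibility of composition with
equivalence, are those of relations.  That a composite is a couple is the one
geometric point about couples: the fibre product of etale groupoids over an
etale groupoid is etale ([fp_etale]), because two local sections of a local
homeomorphism which meet at a point agree near that point.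

For the transformation groupoid, everything rests on the description of
neighbourhoods of a germ: near [[s, x]] the germs are the [[s, y]] with [y]
near [x] ([nbhs_germE]).  It makes [S x| X] etale, and [(phi_xi, psi_theta)] a
couple, whose graph consists of the pairs [([s, xi y], [theta s, y])]
([TG_couple_graph]).  Functoriality is then a computation with these pairs.

For the locally compact Hausdorff subcategories, the unit space of [S x| X] is
homeomorphic to [X], a proper [xi] gives a proper [phi_xi], and a composite of
proper couples is proper because its units over a compact set are the image of
a compact set of units under a continuous section. *)

(** * Etale groupoids *)

Lemma nbhs_comp (X Y : topologicalType) (f : X -> Y) x (W : set Y) :
  continuous f -> nbhs (f x) W -> nbhs x (f @^-1` W).
Proof. by move=> fc; apply: fc. Qed.

Lemma nbhsI (T : topologicalType) (x : T) (A B : set T) :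
  nbhs x A -> nbhs x B -> nbhs x (A `&` B).
Proof. exact: filterI. Qed.

Lemma nbhs_open (T : topologicalType) (A : set T) :
  (forall x, A x -> nbhs x A) -> open A.
Proof. by rewrite openE. Qed.

Section etale.
Variable G : pregroupoid.

Lemma gunit_gd (u : G) : is_groupoid G -> gd u = u -> gunit G u.
Proof. by move=> gG <-; exact: gd_unit. Qed.

(** Openness of the domain map makes its local inverses continuous, so that
local injectivity is all that remains to be found around each arrow. *)
Lemma local_homeo_gd : is_groupoid G -> continuous (@gd G) ->
  (forall g : G, exists2 V, nbhs g V & set_inj V gd) ->
  (forall (g : G) W, nbhs g W -> nbhs (gd g) (gd @` W)) ->
  local_homeo_to (gunit G) (@gd G).
Proof.
move=> gG gdc linj gdo; split=> [|g]; first exact: gd_unit.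
have [V nV injV] := linj g; exists V°.
  by split; [exact: open_interior|exact: nV].
split.
- apply: sub_in2 injV => x; rewrite !in_setE; exact: interior_subset.
- exact: continuous_subspaceT.
- move=> W oW _; exists (gd @` W).
    apply: nbhs_open => _ [x Wx <-]; apply: gdo; exact: open_nbhs_nbhs.
  by rewrite setIidr // => _ [x _ <-]; exact: gd_unit.
Qed.

Hypothesis eG : is_etale G.
Let gG := etale_groupoid eG.

Lemma gd_locally_injective (g : G) :
  exists2 V, nbhs g V & set_inj V gd.
Proof.
have [_ /(_ g)[V gV [Vi _ _]]] := gd_local_homeo eG.
by exists V => //; exact: open_nbhs_nbhs.
Qed.

(** Units are open: near a unit both [g] and its domain lie in a set on which
the domain map is injective, and they have the same domain. *)
Lemma nbhs_gunit (u : G) : gunit G u -> nbhs u (gunit G).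
Proof.
move=> uG; have [V nV injV] := gd_locally_injective u.
have nV' : nbhs u (gd @^-1` V).
  by apply: nbhs_comp; [exact: gd_continuous|rewrite gd_id].
apply: filterS2 nV nV' => g Vg Vdg; apply: gunit_gd => //.
by apply: injV; rewrite ?in_setE // gd_id//; exact: gd_unit.
Qed.

(** As the unit space is open, openness of the domain map relative to it is
openness in the whole groupoid. *)
Lemma nbhs_gd (g : G) W : nbhs g W -> nbhs (gd g) (gd @` W).
Proof.
move=> nW; have [_ /(_ g)[V [oV Vg] [_ _ Vo]]] := gd_local_homeo eG.
have [] := Vo (W° `&` V).
- by apply: openI => //; exact: open_interior.
- by move=> x [].
move=> O oO dE.
have [_ Og] : (gunit G `&` O) (gd g).
  by rewrite -dE; exists g => //; split=> //; exact: nW.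
have nO : nbhs (gd g) O by exact: open_nbhs_nbhs.
have nU := nbhs_gunit (gd_unit gG g).
apply: filterS2 nU nO => u uG Ou.
have : (gunit G `&` O) u by [].
by rewrite -dE => -[x [/interior_subset Wx _] <-]; exists x.
Qed.

End etale.

(** * Inverses and homomorphisms *)

Lemma ginv_unique (G : pregroupoid) (h g : G) : is_groupoid G ->
  gd h = gr g -> gmul h g = gd g -> h = ginv g.
Proof.
move=> gG hg hgE; rewrite -[LHS]gmul_gd // hg -(gmulVr gG g) gmulA ?gr_inv //.
by rewrite hgE -(gr_inv gG) gmul_gr.
Qed.

Lemma ghom_inv (G H : pregroupoid) (f : G -> H) (g : G) :
  is_groupoid G -> is_groupoid H -> is_ghom f -> f (ginv g) = ginv (f g).
Proof.
move=> gG gH hf; apply: ginv_unique => //.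
  by rewrite -(ghom_d hf) -(ghom_r hf) gd_inv.
by rewrite -(ghom_mul hf) ?gd_inv // gmulV // (ghom_d hf).
Qed.

Lemma ghom_comp (G H K : pregroupoid) (f : G -> H) (g : H -> K) :
  is_ghom f -> is_ghom g -> is_ghom (fun x => g (f x)).
Proof.
move=> hf hg; split.
- by move=> u uG; apply: (ghom_unit hg); apply: (ghom_unit hf).
- by move=> x; rewrite (ghom_d hf) (ghom_d hg).
- by move=> x; rewrite (ghom_r hf) (ghom_r hg).
- move=> x y xy; rewrite (ghom_mul hf) // (ghom_mul hg) //.
  by rewrite -(ghom_d hf) -(ghom_r hf) xy.
Qed.

Lemma ghom_id (G : pregroupoid) : is_ghom (@id G).
Proof. by split. Qed.

(** Continuity of the product at composable pairs, without the subspace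
topology on them. *)
Lemma gmul_continuousP (H : pregroupoid) :
  {within @composable H, continuous (fun p : H * H => gmul p.1 p.2)} <->
  forall (h g : H) W, gd h = gr g -> nbhs (gmul h g) W ->
    exists A B, [/\ nbhs h A, nbhs g B &
      forall h' g', A h' -> B g' -> gd h' = gr g' -> W (gmul h' g')].
Proof.
rewrite subspace_continuousP; split=> [mc h g W hg nW|mc].
  have /= [[A B] /= [nA nB] AB] := mc (h, g) hg W nW.
  by exists A, B; split=> // h' g' Ah Bg hg'; exact: (AB (h', g')).
move=> [h g] hg W nW; have [A [B [nA nB AB]]] := mc h g W hg nW.
exists (A, B); first by split.
by move=> [h' g'] [Ah Bg] hg'; exact: AB.
Qed.

(** * The graph of a couple *)

Definition couple_graph (G H : pregroupoid) (c : couple G H) (g : G) (h : H) :=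
  exists2 k, cphi c k = g & cpsi c k = h.

Section couple.
Variables (G H : pregroupoid) (c : couple G H).

(** The unit space of [H] is open, so [psi] is open on units even as a map to
[H]. *)
Lemma couple_psi_nbhs u W : is_etale H -> is_couple c ->
  gunit (cK c) u -> nbhs u W ->
  nbhs (cpsi c u) (cpsi c @` (W `&` gunit (cK c))).
Proof.
move=> eH cc uK nW.
have [|O oO E] := couple_psi_open cc (W := gunit (cK c) `&` W°).
  by exists W° => //; exact: open_interior.
have [Hu Ou] : (gunit H `&` O) (cpsi c u).
  by rewrite -E; exists u => //; split=> //; exact: nW.
have nO : nbhs (cpsi c u) O by exact: open_nbhs_nbhs.
apply: filterS2 (nbhs_gunit eH Hu) nO => v Hv Ov.
have : (gunit H `&` O) v by [].
by rewrite -E => -[x [xK /interior_subset Wx] <-]; exists x.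
Qed.

Lemma couple_psi_openI : is_ghom (cpsi c) ->
  (forall u W, gunit (cK c) u -> nbhs u W ->
    nbhs (cpsi c u) (cpsi c @` (W `&` gunit (cK c)))) ->
  forall W : set (cK c),
    open_in (gunit (cK c)) W -> open_in (gunit H) (cpsi c @` W).
Proof.
move=> hpsi psio _ [O oO ->]; exists (cpsi c @` (gunit (cK c) `&` O)).
  apply: nbhs_open => _ [u [uK Ou] <-]; rewrite setIC; apply: psio => //.
  exact: open_nbhs_nbhs.
by apply/esym/setIidr => _ [u [uK _] <-]; exact: (ghom_unit hpsi).
Qed.

Hypothesis cc : is_couple c.
Let gK := etale_groupoid (couple_etale cc).

Lemma couple_gd_inj k k' :
  cphi c k = cphi c k' -> gd k = gd k' -> k = k'.
Proof.
have [_ inj _] := couple_phi_bij cc (gd_unit gK k) => pk dk.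
by apply: inj; rewrite ?in_setE.
Qed.

Lemma couple_psi_gd_inj k k' : cpsi c (gd k) = cpsi c (gd k') -> gd k = gd k'.
Proof. by apply: (couple_psi_inj cc); rewrite in_setE; exact: gd_unit. Qed.

Lemma couple_inj k k' : cphi c k = cphi c k' -> cpsi c k = cpsi c k' -> k = k'.
Proof.
move=> phiE psiE; apply: couple_gd_inj => //; apply: couple_psi_gd_inj.
by rewrite !(ghom_d (couple_psi_hom cc)) psiE.
Qed.

(** Why [k |-> (phi k, psi k)] is an embedding.  If [psi k'] is close to
[psi k], its domain is the image of the domain of some [k1] close to [k], and
injectivity of [psi] on units gives [k'] and [k1] the same domain.  Then
[phi k'] and [phi k1] are both close to [phi k] and have the same domain, so
they agree, and [k' = k1] by injectivity on fibres. *)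
Lemma couple_embedding k W : is_etale G -> is_etale H -> nbhs k W ->
  exists A B, [/\ nbhs (cphi c k) A, nbhs (cpsi c k) B &
    forall k', A (cphi c k') -> B (cpsi c k') -> W k'].
Proof.
move=> eG eH nW; have [V nV injV] := gd_locally_injective eG (cphi c k).
have nV' : nbhs k (cphi c @^-1` V).
  by apply: nbhs_comp => //; exact: couple_phi_continuous.
pose D := gd @` (W `&` cphi c @^-1` V).
have nD : nbhs (gd k) D := nbhs_gd (couple_etale cc) (nbhsI nW nV').
have nB := couple_psi_nbhs eH cc (gd_unit gK k) nD.
rewrite (ghom_d (couple_psi_hom cc)) in nB.
exists V, (gd @^-1` (cpsi c @` (D `&` gunit (cK c)))).
split=> //; first by apply: nbhs_comp => //; exact: gd_continuous.
move=> k' Vk' [_ [[k1 [Wk1 Vk1] <-] _]].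
rewrite -(ghom_d (couple_psi_hom cc)) => /couple_psi_gd_inj dE.
suff -> : k' = k1 by [].
apply: couple_gd_inj => //; apply: injV; rewrite ?in_setE //.
by rewrite -!(ghom_d (couple_phi_hom cc)) dE.
Qed.

End couple.

Section couple_eqP.
Variables (G H : pregroupoid) (c1 c2 : couple G H).
Hypotheses (eG : is_etale G) (eH : is_etale H).

Lemma couple_eq_graph : couple_eq c1 c2 ->
  forall g h, couple_graph c1 g h <-> couple_graph c2 g h.
Proof.
move=> [i [j [[ij ji _ _] [_ phiE psiE]]]] g h; split=> -[k <- <-].
  by exists (i k); [exact: phiE|exact: psiE].
by exists (j k); rewrite -?phiE -?psiE /= ji.
Qed.

(** The comparison map: it sends [k] to the point of [K2] with the same image
in [G x H].  It is continuous because [K2] is embedded in [G x H], and it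
preserves the operations because [K2] is a subgroupoid there. *)
Lemma couple_graph_map : is_couple c1 -> is_couple c2 ->
  (forall g h, couple_graph c1 g h -> couple_graph c2 g h) ->
  exists i : cK c1 -> cK c2,
    [/\ continuous i, is_ghom i, cphi c2 \o i =1 cphi c1
      & cpsi c2 \o i =1 cpsi c1].
Proof.
move=> cc1 cc2 sub.
have /choice[i iP] k :
    exists k2, cphi c2 k2 = cphi c1 k /\ cpsi c2 k2 = cpsi c1 k.
  have [|k2 ? ?] := sub (cphi c1 k) (cpsi c1 k); first by exists k.
  by exists k2.
have phiE k : cphi c2 (i k) = cphi c1 k by have [] := iP k.
have psiE k : cpsi c2 (i k) = cpsi c1 k by have [] := iP k.
have [hphi1 hpsi1] := (couple_phi_hom cc1, couple_psi_hom cc1).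
have [hphi2 hpsi2] := (couple_phi_hom cc2, couple_psi_hom cc2).
have inj := couple_inj cc2.
have id k : i (gd k) = gd (i k).
  apply: inj; first by rewrite phiE (ghom_d hphi1) (ghom_d hphi2) phiE.
  by rewrite psiE (ghom_d hpsi1) (ghom_d hpsi2) psiE.
have ir k : i (gr k) = gr (i k).
  apply: inj; first by rewrite phiE (ghom_r hphi1) (ghom_r hphi2) phiE.
  by rewrite psiE (ghom_r hpsi1) (ghom_r hpsi2) psiE.
have gK1 := etale_groupoid (couple_etale cc1).
have gK2 := etale_groupoid (couple_etale cc2).
exists i; split=> //.
  move=> k W /= nW; have [A [B [nA nB AB]]] := couple_embedding cc2 eG eH nW.
  rewrite phiE in nA; rewrite psiE in nB.
  have nA' := nbhs_comp (couple_phi_continuous cc1) nA.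
  have nB' := nbhs_comp (couple_psi_continuous cc1) nB.
  by apply: filterS2 nA' nB' => k' Ak Bk; apply: AB; rewrite ?phiE ?psiE.
split=> //; first by move=> u uK; apply: gunit_gd => //; rewrite -id gd_id.
move=> h g hg; have ihg : gd (i h) = gr (i g) by rewrite -id -ir hg.
apply: inj.
  by rewrite phiE (ghom_mul hphi1) // (ghom_mul hphi2) // !phiE.
by rewrite psiE (ghom_mul hpsi1) // (ghom_mul hpsi2) // !psiE.
Qed.

End couple_eqP.

Lemma couple_eqP (G H : pregroupoid) (c1 c2 : couple G H) :
  is_etale G -> is_etale H -> is_couple c1 -> is_couple c2 ->
  couple_eq c1 c2 <-> forall g h, couple_graph c1 g h <-> couple_graph c2 g h.
Proof.
move=> eG eH cc1 cc2; split=> [|E]; first exact: couple_eq_graph.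
have [i [ic ih phii psii]] :=
  couple_graph_map eG eH cc1 cc2 (fun g h => (E g h).1).
have [j [jc _ phij psij]] :=
  couple_graph_map eG eH cc2 cc1 (fun g h => (E g h).2).
exists i, j; split=> //; split=> // k.
  apply: (couple_inj cc1); first by rewrite [LHS]phij; exact: phii.
  by rewrite [LHS]psij; exact: psii.
apply: (couple_inj cc2); first by rewrite [LHS]phii; exact: phij.
by rewrite [LHS]psii; exact: psij.
Qed.

Lemma couple_id_graph (G : pregroupoid) (g h : G) :
  couple_graph (couple_id G) g h <-> g = h.
Proof. by split=> [[k <- <-]|->] //; exists h. Qed.

Lemma couple_comp_graph (G1 G2 G3 : pregroupoid)
  (c2 : couple G2 G3) (c1 : couple G1 G2) g h :
  couple_graph (couple_comp c2 c1) g h <->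
  exists2 m, couple_graph c1 g m & couple_graph c2 m h.
Proof.
split.
  move=> [[p pP] /= <- <-]; exists (cpsi c1 p.1); first by exists p.1.
  by exists p.2 => //; have := set_mem pP => /= ->.
move=> [m [k1 <- <-] [k2 kE <-]].
have kP : [set p | cpsi c1 p.1 = cphi c2 p.2] (k1, k2) by exact: esym.
by exists (exist _ (k1, k2) (mem_set kP)).
Qed.

(** * Fibre products *)

Section fibre_product.
Variables (K1 K2 G : pregroupoid) (psi : K1 -> G) (phi : K2 -> G).
Let P := fibre_product psi phi.

Definition fp1 (p : P) : K1 := (val p).1.
Definition fp2 (p : P) : K2 := (val p).2.

Lemma fp_eq p : psi (fp1 p) = phi (fp2 p).
Proof. exact: (set_mem (valP p)). Qed.

Lemma fp_inj p q : fp1 p = fp1 q -> fp2 p = fp2 q -> p = q.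
Proof.
move=> E1 E2; apply: val_inj.
by rewrite [LHS]surjective_pairing [RHS]surjective_pairing; congr pair.
Qed.

Lemma fp_ex k1 k2 : psi k1 = phi k2 ->
  exists p : P, fp1 p = k1 /\ fp2 p = k2.
Proof.
move=> kE.
have kP : [set p | psi p.1 = phi p.2] (k1, k2) by [].
by exists (exist _ (k1, k2) (mem_set kP)).
Qed.

Lemma fp_insubd (p : P) k1 k2 : psi k1 = phi k2 ->
  (fp1 (insubd p (k1, k2)) = k1) * (fp2 (insubd p (k1, k2)) = k2).
Proof. by move=> E; rewrite /fp1 /fp2 !insubdK //; exact: mem_set. Qed.

(** Boxes form a base of the topology of the fibre product; with this, each
topological statement reduces to the two factors. *)
Lemma nbhs_fpP (p : P) (W : set P) : nbhs p W <->
  exists A B, [/\ nbhs (fp1 p) A, nbhs (fp2 p) B &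
    forall q : P, A (fp1 q) -> B (fp2 q) -> W q].
Proof.
split.
  move=> [_ [[O oO <-] Op] sub].
  have /= [[A B] /= [nA nB] AB] : nbhs (val p) O by exact: open_nbhs_nbhs.
  by exists A, B; split=> // q Aq Bq; apply: sub; apply: AB.
move=> [A [B [nA nB AB]]].
have vc : continuous (val : P -> K1 * K2) by exact: initial_continuous.
have : nbhs (val p) (A `*` B) by exists (A, B).
by move=> /(nbhs_comp vc); apply: filterS => q [Aq Bq]; exact: AB.
Qed.

Lemma fp1_continuous : continuous fp1.
Proof.
move=> p A nA; apply/nbhs_fpP; exists A, setT.
by split=> //; exact: filterT.
Qed.

Lemma fp2_continuous : continuous fp2.
Proof.
move=> p A nA; apply/nbhs_fpP; exists setT, A.
by split=> //; exact: filterT.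
Qed.

Hypotheses (hpsi : is_ghom psi) (hphi : is_ghom phi).

Lemma fp_gd (p : P) : (fp1 (gd p) = gd (fp1 p)) * (fp2 (gd p) = gd (fp2 p)).
Proof.
by apply: fp_insubd; rewrite (ghom_d hpsi) (ghom_d hphi) -/(fp1 p) fp_eq.
Qed.

Lemma fp_gr (p : P) : (fp1 (gr p) = gr (fp1 p)) * (fp2 (gr p) = gr (fp2 p)).
Proof.
by apply: fp_insubd; rewrite (ghom_r hpsi) (ghom_r hphi) -/(fp1 p) fp_eq.
Qed.

Lemma fp_composable (q p : P) : gd q = gr p ->
  gd (fp1 q) = gr (fp1 p) /\ gd (fp2 q) = gr (fp2 p).
Proof. by rewrite -!fp_gd -!fp_gr => ->. Qed.

Lemma fp_gmul (q p : P) : gd q = gr p ->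
  (fp1 (gmul q p) = gmul (fp1 q) (fp1 p)) *
  (fp2 (gmul q p) = gmul (fp2 q) (fp2 p)).
Proof.
move=> /fp_composable[E1 E2]; apply: fp_insubd.
by rewrite (ghom_mul hpsi) // (ghom_mul hphi) // -/(fp1 _) -/(fp1 _) !fp_eq.
Qed.

Lemma fp1_ghom : is_ghom fp1.
Proof.
split.
- by move=> u [].
- by move=> g; rewrite fp_gd.
- by move=> g; rewrite fp_gr.
- by move=> h g hg; rewrite fp_gmul.
Qed.

Lemma fp2_ghom : is_ghom fp2.
Proof.
split.
- by move=> u [].
- by move=> g; rewrite fp_gd.
- by move=> g; rewrite fp_gr.
- by move=> h g hg; rewrite fp_gmul.
Qed.

End fibre_product.

Section fibre_product_etale.
Variables (K1 K2 G : pregroupoid) (psi : K1 -> G) (phi : K2 -> G).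
Hypotheses (eK1 : is_etale K1) (eK2 : is_etale K2) (eG : is_etale G).
Hypotheses (hpsi : is_ghom psi) (hphi : is_ghom phi).
Hypotheses (psic : continuous psi) (phic : continuous phi).
Let P := fibre_product psi phi.
Let gK1 := etale_groupoid eK1.
Let gK2 := etale_groupoid eK2.
Let gG := etale_groupoid eG.

Lemma fp_ginv (p : P) :
  (fp1 (ginv p) = ginv (fp1 p)) * (fp2 (ginv p) = ginv (fp2 p)).
Proof. by apply: fp_insubd; rewrite !(ghom_inv _ _ gG) // -/(fp1 p) fp_eq. Qed.

Lemma fp_groupoid : is_groupoid P.
Proof.
have cd (g h : P) :
    gd (fp1 g) = gr (fp1 h) -> gd (fp2 g) = gr (fp2 h) -> gd g = gr h.
  by move=> E1 E2; apply: fp_inj; rewrite fp_gd // fp_gr.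
have gdV g : gd (ginv g) = gr g :> P.
  by apply: fp_inj; rewrite fp_gd // fp_gr // fp_ginv gd_inv.
have grV g : gr (ginv g) = gd g :> P.
  by apply: fp_inj; rewrite fp_gd // fp_gr // fp_ginv gr_inv.
have gdu g : gunit P (gd g).
  by split; rewrite -/(fp1 _) -/(fp2 _) fp_gd //; exact: gd_unit.
have gru g : gunit P (gr g).
  by split; rewrite -/(fp1 _) -/(fp2 _) fp_gr //; exact: gr_unit.
have gdI u : gunit P u -> gd u = u.
  by move=> [u1 u2]; apply: fp_inj; rewrite fp_gd // gd_id.
have grI u : gunit P u -> gr u = u.
  by move=> [u1 u2]; apply: fp_inj; rewrite fp_gr // gr_id.
have gdM h g : gd h = gr g -> gd (gmul h g) = gd g :> P.
  move=> /[dup] /(fp_composable hpsi hphi)[E1 E2] E.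
  by apply: fp_inj; rewrite !fp_gd // fp_gmul // gd_mul.
have grM h g : gd h = gr g -> gr (gmul h g) = gr h :> P.
  move=> /[dup] /(fp_composable hpsi hphi)[E1 E2] E.
  by apply: fp_inj; rewrite !fp_gr // fp_gmul // gr_mul.
split=> //.
- move=> k h g kh hg.
  have [E1 E2] := fp_composable hpsi hphi kh.
  have [F1 F2] := fp_composable hpsi hphi hg.
  by apply: fp_inj; rewrite !fp_gmul ?grM ?gdM // gmulA.
- by move=> g; apply: fp_inj; rewrite fp_gmul ?grI // fp_gd // gmul_gd.
- by move=> g; apply: fp_inj; rewrite fp_gmul ?gdI // fp_gr // gmul_gr.
- by move=> g; apply: fp_inj; rewrite fp_gmul // fp_ginv fp_gd // gmulV.
- by move=> g; apply: fp_inj; rewrite fp_gmul // fp_ginv fp_gr // gmulVr.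
Qed.

Lemma fp_gd_continuous : continuous (@gd P).
Proof.
move=> p W /nbhs_fpP[A [B [nA nB AB]]]; apply/nbhs_fpP.
rewrite (fp_gd hpsi hphi) in nA; rewrite (fp_gd hpsi hphi) in nB.
exists (gd @^-1` A), (gd @^-1` B); split.
- by apply: nbhs_comp nA; exact: (gd_continuous eK1).
- by apply: nbhs_comp nB; exact: (gd_continuous eK2).
- by move=> q Aq Bq; apply: AB; rewrite fp_gd.
Qed.

Lemma fp_gr_continuous : continuous (@gr P).
Proof.
move=> p W /nbhs_fpP[A [B [nA nB AB]]]; apply/nbhs_fpP.
rewrite (fp_gr hpsi hphi) in nA; rewrite (fp_gr hpsi hphi) in nB.
exists (gr @^-1` A), (gr @^-1` B); split.
- by apply: nbhs_comp nA; exact: (gr_continuous eK1).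
- by apply: nbhs_comp nB; exact: (gr_continuous eK2).
- by move=> q Aq Bq; apply: AB; rewrite fp_gr.
Qed.

Lemma fp_ginv_continuous : continuous (@ginv P).
Proof.
move=> p W /nbhs_fpP[A [B [nA nB AB]]]; apply/nbhs_fpP.
rewrite fp_ginv in nA; rewrite fp_ginv in nB.
exists (ginv @^-1` A), (ginv @^-1` B); split.
- by apply: nbhs_comp nA; exact: (ginv_continuous eK1).
- by apply: nbhs_comp nB; exact: (ginv_continuous eK2).
- by move=> q Aq Bq; apply: AB; rewrite fp_ginv.
Qed.

Lemma fp_gmul_continuous :
  {within @composable P, continuous (fun p : P * P => gmul p.1 p.2)}.
Proof.
apply/gmul_continuousP => h g W hg /nbhs_fpP[A [B [nA nB AB]]].
rewrite fp_gmul // in nA; rewrite fp_gmul // in nB.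
have [E1 E2] := fp_composable hpsi hphi hg.
have [A1 [A2 [nA1 nA2 A12]]] :=
  (gmul_continuousP K1).1 (gmul_continuous eK1) _ _ _ E1 nA.
have [B1 [B2 [nB1 nB2 B12]]] :=
  (gmul_continuousP K2).1 (gmul_continuous eK2) _ _ _ E2 nB.
exists [set q | A1 (fp1 q) /\ B1 (fp2 q)], [set q | A2 (fp1 q) /\ B2 (fp2 q)].
split; [by apply/nbhs_fpP; exists A1, B1|by apply/nbhs_fpP; exists A2, B2|].
move=> h' g' [? ?] [? ?] hg'; have [F1 F2] := fp_composable hpsi hphi hg'.
by apply: AB; rewrite fp_gmul //; [exact: A12|exact: B12].
Qed.

Lemma fp_locally_injective (p : P) : exists2 V, nbhs p V & set_inj V gd.
Proof.
have [V1 nV1 i1] := gd_locally_injective eK1 (fp1 p).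
have [V2 nV2 i2] := gd_locally_injective eK2 (fp2 p).
exists [set q | V1 (fp1 q) /\ V2 (fp2 q)].
  by apply/nbhs_fpP; exists V1, V2.
move=> q q'; rewrite !in_setE => -[? ?] [? ?] E.
have [E1 E2] := (congr1 (@fp1 _ _ _ psi phi) E, congr1 (@fp2 _ _ _ psi phi) E).
rewrite !fp_gd // in E1; rewrite !fp_gd // in E2.
by apply: fp_inj; [apply: i1|apply: i2]; rewrite ?in_setE.
Qed.

(** Openness of the domain map.  A unit [(u1, u2)] near the domain of
[(k1, k2)] lifts to some [k1'] and [k2'] near [k1] and [k2]; the pair lies in
the fibre product because [psi k1'] and [phi k2'] have the same domain and lie
in a set where the domain map of [G] is injective. *)
Lemma nbhs_fp_gd (p : P) W : nbhs p W -> nbhs (gd p) (gd @` W).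
Proof.
move=> /nbhs_fpP[A [B [nA nB AB]]].
have [V nV injV] := gd_locally_injective eG (psi (fp1 p)).
have nA' : nbhs (fp1 p) (A `&` psi @^-1` V).
  by apply: filterI => //; exact: nbhs_comp.
have nB' : nbhs (fp2 p) (B `&` phi @^-1` V).
  by apply: filterI => //; apply: nbhs_comp => //; rewrite -fp_eq.
apply/nbhs_fpP; rewrite !(fp_gd hpsi hphi).
exists (gd @` (A `&` psi @^-1` V)), (gd @` (B `&` phi @^-1` V)).
split; [exact: (nbhs_gd eK1)|exact: (nbhs_gd eK2)|].
move=> q [k1 [Ak1 Vk1] d1] [k2 [Bk2 Vk2] d2].
have /(@fp_ex _ _ _ psi phi)[p' [p'1 p'2]] : psi k1 = phi k2.
  apply: injV; rewrite ?in_setE //.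
  by rewrite -(ghom_d hpsi) -(ghom_d hphi) d1 d2 fp_eq.
exists p'; first by apply: AB; rewrite ?p'1 ?p'2.
by apply: fp_inj; rewrite fp_gd // ?p'1 ?p'2.
Qed.

Lemma fp_etale : is_etale P.
Proof.
split.
- exact: fp_groupoid.
- exact: fp_gd_continuous.
- exact: fp_gr_continuous.
- exact: fp_ginv_continuous.
- exact: fp_gmul_continuous.
- apply: local_homeo_gd; [exact: fp_groupoid|exact: fp_gd_continuous| |].
    exact: fp_locally_injective.
  exact: nbhs_fp_gd.
Qed.

End fibre_product_etale.

(** * Composition of couples *)

Section couple_category.
Variables (G1 G2 G3 : pregroupoid).
Hypotheses (e1 : is_etale G1) (e2 : is_etale G2) (e3 : is_etale G3).
Variables (c2 : couple G2 G3) (c1 : couple G1 G2).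
Hypotheses (cc1 : is_couple c1) (cc2 : is_couple c2).

(** On the units of a composite, the first coordinate is a continuous function
of the second one, because [psi] of the first couple is a homeomorphism onto
an open set of units. *)
Lemma couple_unit_section u2 : gunit (cK c2) u2 ->
  forall u1, gunit (cK c1) u1 -> cpsi c1 u1 = cphi c2 u2 ->
  forall A, nbhs u1 A -> nbhs u2 [set v2 |
    exists2 v1, A v1 & gunit (cK c1) v1 /\ cpsi c1 v1 = cphi c2 v2].
Proof.
move=> u2K u1 u1K E A nA; have := couple_psi_nbhs e2 cc1 u1K nA.
rewrite E => /(nbhs_comp (couple_phi_continuous cc2)).
by apply: filterS => v2 [v1 [Av1 v1K] vE]; exists v1.
Qed.

Lemma couple_comp_is_couple : is_couple (couple_comp c2 c1).
Proof.
have [hpsi hphi] := (couple_psi_hom cc1, couple_phi_hom cc2).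
have psic := couple_psi_continuous cc1; have phic := couple_phi_continuous cc2.
have [eK1 eK2] := (couple_etale cc1, couple_etale cc2).
have hs : is_ghom (cpsi (couple_comp c2 c1)).
  by apply: ghom_comp (couple_psi_hom cc2); exact: fp2_ghom.
pose p1 := @fp1 _ _ _ (cpsi c1) (cphi c2).
pose p2 := @fp2 _ _ _ (cpsi c1) (cphi c2).
split.
- exact: fp_etale.
- by apply: ghom_comp (couple_phi_hom cc1); exact: fp1_ghom.
- move=> p; apply: (@continuous_comp _ _ _ p1 (cphi c1)).
    exact: fp1_continuous.
  exact: couple_phi_continuous.
- move=> u [u1K u2K].
  have [phi1d inj1 surj1] := couple_phi_bij cc1 u1K.
  have [phi2d inj2 surj2] := couple_phi_bij cc2 u2K.
  have fibreE p : gfibre u p -> gd (p1 p) = p1 u /\ gd (p2 p) = p2 u.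
    by move=> <-; rewrite /p1 /p2 !fp_gd.
  split.
  + by move=> p /fibreE[p1u _]; exact: phi1d.
  + move=> p q; rewrite !in_setE => /fibreE[p1u p2u] /fibreE[q1u q2u] phiE.
    have E1 : p1 p = p1 q by apply: inj1; rewrite ?in_setE.
    apply: fp_inj => //; apply: inj2; rewrite ?in_setE // -!fp_eq.
    by congr (cpsi c1 _).
  + move=> g /surj1[k1 k1u k1g].
    have [|k2 k2u k2E] := surj2 (cpsi c1 k1).
      by rewrite /gfibre /= -(ghom_d hpsi) k1u; exact: (fp_eq u).
    have [p [pE1 pE2]] := fp_ex (esym k2E).
    exists p; last by rewrite -k1g -pE1.
    by apply: fp_inj; rewrite fp_gd // ?pE1 ?pE2.
- exact: hs.
- move=> p; apply: (@continuous_comp _ _ _ p2 (cpsi c2)).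
    exact: fp2_continuous.
  exact: couple_psi_continuous.
- move=> p q; rewrite !in_setE => -[p1K p2K] [q1K q2K] psiE.
  have E2 : p2 p = p2 q by apply: (couple_psi_inj cc2); rewrite ?in_setE.
  apply: fp_inj => //; apply: (couple_psi_inj cc1); rewrite ?in_setE // !fp_eq.
  by congr (cphi c2 _).
- apply: couple_psi_openI => // u W [u1K u2K] /nbhs_fpP[A [B [nA nB AB]]].
  have nS := couple_unit_section u2K u1K (fp_eq u) nA.
  apply: filterS (couple_psi_nbhs e3 cc2 u2K (nbhsI nB nS)).
  move=> _ [v2 [[Bv2 [v1 Av1 [v1K vE]]] v2K] <-].
  have [p [pE1 pE2]] := fp_ex vE; exists p; last by rewrite -pE2.
  split; first by apply: AB; rewrite ?pE1 ?pE2.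
  by split; rewrite -/(fp1 p) -/(fp2 p) ?pE1 ?pE2.
Qed.

(** Over a compact set [C], the units of the first factor form a compact set,
and so do the units of the second factor over its image; the units of the
composite are the image of the latter by the section of
[couple_unit_section], so that a filter on them clusters as soon as its second
projection does. *)
Lemma couple_comp_proper : proper_couple c1 -> proper_couple c2 ->
  proper_couple (couple_comp c2 c1).
Proof.
move=> pr1 pr2 C CG Cc.
pose D1 := gunit (cK c1) `&` cphi c1 @^-1` C.
have D1c : compact D1 by exact: pr1.
pose D2 := gunit (cK c2) `&` cphi c2 @^-1` (cpsi c1 @` D1).
have D2c : compact D2.
  apply: pr2.
    by move=> _ [u [uK _] <-]; exact: (ghom_unit (couple_psi_hom cc1)).
  apply: continuous_compact => //; apply: continuous_subspaceT.
  exact: couple_psi_continuous.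
pose p2 := @fp2 _ _ _ (cpsi c1) (cphi c2).
move=> F FF FS.
have FD : F (p2 @^-1` D2).
  apply: filterS FS => p [[p1K p2K] Cp]; split=> //.
  by exists (fp1 p) => //; exact: fp_eq.
have [k2 [[k2K [k1 [k1K Ck1] kE]] clk2]] := D2c (p2 @ F) _ FD.
have [p [pE1 pE2]] := fp_ex kE.
exists p; split.
  by split; [split|]; rewrite /= -/(fp1 p) -/(fp2 p) ?pE1 ?pE2.
move=> E W FE /nbhs_fpP[A [B [nA nB AB]]]; rewrite pE1 in nA; rewrite pE2 in nB.
have nS := couple_unit_section k2K k1K kE nA.
pose E' := E `&` gunit (cK (couple_comp c2 c1)).
have FE' : F (p2 @^-1` (p2 @` E')).
  apply: filterS2 FE FS => q Eq [qK _]; exact: (imageP _ (conj Eq qK : E' q)).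
have [_ [[q [Eq [q1K q2K]] <-] [Bq [v1 Av1 [v1K vE]]]]] :=
  clk2 _ _ FE' (nbhsI nB nS).
exists q; split=> //; apply: AB => //.
suff -> : fp1 q = v1 by [].
by apply: (couple_psi_inj cc1); rewrite ?in_setE // vE; exact: fp_eq.
Qed.

End couple_category.

(** * Categories of couples *)

Lemma couple_id_is_couple (G : pregroupoid) :
  is_etale G -> is_couple (couple_id G).
Proof.
have idc : continuous (@id G) by move=> g W.
move=> eG; split=> //; try exact: ghom_id.
- by move=> u uG; split=> //= g gu; exists g.
- by move=> W oW; rewrite /= image_id.
Qed.

Lemma couple_id_proper (G : pregroupoid) : proper_couple (couple_id G).
Proof. by move=> C CG Cc; rewrite /= preimage_id setIidr. Qed.

(** All the laws are read off from graphs; only closure under identities and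
composition depends on the class. *)
Lemma groupoid_category (P : category_class groupoid_data) :
  (forall G, in_ob P G -> is_etale G) ->
  (forall G H (c : couple G H), in_hom P c -> is_couple c) ->
  (forall G, in_ob P G -> in_hom P (couple_id G)) ->
  (forall G1 G2 G3 (c2 : couple G2 G3) (c1 : couple G1 G2),
     arrow (C := groupoid_data) P c2 -> arrow (C := groupoid_data) P c1 ->
     in_hom P (couple_comp c2 c1)) ->
  is_category P.
Proof.
move=> Pob Phom Pid Pcomp.
have eqP G H (c c' : couple G H) :
    arrow (C := groupoid_data) P c -> arrow (C := groupoid_data) P c' ->
    couple_eq c c' <-> forall g h, couple_graph c g h <-> couple_graph c' g h.
  move=> [PG PH Pc] [_ _ Pc'].
  apply: couple_eqP; [exact: Pob|exact: Pob|exact: Phom|exact: Phom].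
have aid G : in_ob P G -> arrow (C := groupoid_data) P (couple_id G).
  by move=> PG; split=> //; exact: Pid.
have acomp G1 G2 G3 (c2 : couple G2 G3) (c1 : couple G1 G2) :
    arrow (C := groupoid_data) P c2 -> arrow (C := groupoid_data) P c1 ->
    arrow (C := groupoid_data) P (couple_comp c2 c1).
  by move=> a2 a1; split; [have [] := a1|have [] := a2|exact: Pcomp].
split=> //=.
- by move=> G H c ac; apply/eqP.
- move=> G H c c' ac ac' /(eqP _ _ _ _ ac ac') E; apply/eqP => // g h.
  by split=> /E.
- move=> G H c c' c'' ac ac' ac''.
  move=> /(eqP _ _ _ _ ac ac') E /(eqP _ _ _ _ ac' ac'') E'.
  by apply/eqP => // g h; split=> [/E/E'|/E'/E].
- move=> G1 G2 G3 d d' c c' ad ad' ac ac'.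
  move=> /(eqP _ _ _ _ ad ad') E /(eqP _ _ _ _ ac ac') E'.
  apply/eqP; [exact: acomp|exact: acomp|] => g h.
  split=> /couple_comp_graph[m /E' gm /E mh];
    by apply/couple_comp_graph; exists m.
- move=> G H c ac; have [PG PH _] := ac; apply/eqP => //.
    by apply: acomp => //; exact: aid.
  move=> g h; split=> [/couple_comp_graph[m gm /couple_id_graph <-] //|gh].
  by apply/couple_comp_graph; exists h => //; apply/couple_id_graph.
- move=> G H c ac; have [PG PH _] := ac; apply/eqP => //.
    by apply: acomp => //; exact: aid.
  move=> g h; split=> [/couple_comp_graph[m /couple_id_graph <-] //|gh].
  by apply/couple_comp_graph; exists g => //; apply/couple_id_graph.
- move=> G1 G2 G3 G4 c3 c2 c1 a3 a2 a1; apply/eqP.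
  + by apply: (acomp _ _ _ _ _ a3); exact: acomp.
  + by apply: (acomp _ _ _ _ _ _ a1); exact: acomp.
  move=> g h; split.
    move=> /couple_comp_graph[m /couple_comp_graph[l gl lm] mh].
    apply/couple_comp_graph; exists l => //.
    by apply/couple_comp_graph; exists m.
  move=> /couple_comp_graph[l gl /couple_comp_graph[m lm mh]].
  apply/couple_comp_graph; exists m => //.
  by apply/couple_comp_graph; exists l.
Qed.

(** * Germs of an inverse semigroup action *)

Section inverse_semigroup.
Variable S : inverseSemigroupType.
Implicit Types s t e f : S.

Lemma idempotent_starM s : idempotents (star s * s).
Proof. by rewrite /idempotents /= mulgA (mulg_star s).2. Qed.

Lemma idempotentM e f : idempotents e -> idempotents f -> idempotents (e * f).
Proof.
move=> eI fI; rewrite /idempotents /= -mulgA (mulgA f) -(idempotentC eI fI).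
by rewrite -mulgA fI mulgA eI.
Qed.

(** An idempotent [f] moved through [s] becomes the idempotent
[star s * f * s], whose domain consists of the points that [s] maps to the
domain of [f]. *)
Lemma mulg_conj_idempotent s f : idempotents f -> s * (star s * f * s) = f * s.
Proof.
move=> fI; have sI : idempotents (s * star s).
  by rewrite /idempotents /= mulgA (mulg_star s).1.
by rewrite !mulgA (idempotentC sI fI) -!mulgA (mulgA s) (mulg_star s).1.
Qed.

Lemma idempotent_conj s f : idempotents f -> idempotents (star s * f * s).
Proof.
move=> fI; have := mulg_conj_idempotent s fI.
rewrite /idempotents /= -!mulgA => ->.
by rewrite (mulgA f) fI.
Qed.

Lemma star_mul_idempotent s e : idempotents e -> star (s * e) = e * star s.
Proof.
move=> eI; have sI := idempotent_starM s; symmetry; apply: star_uniq; split.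
  rewrite -!mulgA (mulgA e e) eI (mulgA (star s)) (mulgA e) (idempotentC eI sI).
  by rewrite -(mulgA _ e e) eI !mulgA (mulg_star s).1.
rewrite -!mulgA (mulgA e e) eI (mulgA (star s)) (mulgA (star s * s)).
rewrite -(idempotentC eI sI) -!mulgA (mulgA e e) eI.
by rewrite (mulgA (star s)) (mulg_star s).2.
Qed.

End inverse_semigroup.

Lemma nbhs_ppre (X Y : topologicalType) (f : X -> option Y) x y V :
  is_pmap f -> f x = Some y -> nbhs y V -> nbhs x (ppre f V).
Proof.
move=> [_ fo] fx nV.
have : nbhs x (ppre f V°).
  apply: open_nbhs_nbhs; split; first by apply: fo; exact: open_interior.
  by exists y.
by apply: filterS => z [w fz /interior_subset Vw]; exists w.
Qed.

Section germs.
Variable A : action.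
Implicit Types (s t e f : asg A) (x y z : asp A) (g h u v : germ A).

Lemma act_pmap s : is_pmap (act A s).
Proof. by have [] := act_homeo s. Qed.

Lemma nbhs_pdom s x : pdom (act A s) x -> nbhs x (pdom (act A s)).
Proof.
by move=> Dx; apply: open_nbhs_nbhs; split=> //; have [] := act_pmap s.
Qed.

Lemma act_mul_some s t x y z : act A s x = Some y -> act A t y = Some z ->
  act A (t * s) x = Some z.
Proof. by move=> sx ty; rewrite actM /pcomp sx. Qed.

Lemma act_mul_idempotent s e x : idempotents e -> pdom (act A e) x ->
  act A (s * e) x = act A s x.
Proof. by move=> eI De; rewrite actM /pcomp (act_idempotent eI De). Qed.

Lemma pdom_mul_idempotent e f x : idempotents e -> idempotents f ->
  pdom (act A e) x -> pdom (act A f) x -> pdom (act A (e * f)) x.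
Proof. by move=> eI fI De Df; rewrite /pdom /= act_mul_idempotent. Qed.

Lemma is_germ_dom g s x : is_germ g s x -> pdom (act A s) x.
Proof. by move=> [p pE _]; have := set_mem (valP p); rewrite /= pE. Qed.

Lemma is_germ_eqP g h s t x y : is_germ g s x -> is_germ h t y ->
  g = h <->
  x = y /\ exists e, [/\ idempotents e, pdom (act A e) x & s * e = t * e].
Proof.
move=> [p pE ->] [q qE ->]; split.
  by move=> /eqmodP /asboolP; rewrite pE qE.
by move=> H; apply/eqmodP/asboolP; rewrite pE qE.
Qed.

Lemma is_germ_act g s t x y : is_germ g s x -> is_germ g t y ->
  x = y /\ act A s x = act A t y.
Proof.
move=> gs gt; have [xy [e [eI De E]]] := (is_germ_eqP gs gt).1 erefl.
split=> //; rewrite -xy.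
by rewrite -(act_mul_idempotent s eI De) E act_mul_idempotent.
Qed.

Lemma is_germ_src g s t x y : is_germ g s x -> is_germ g t y -> x = y.
Proof. by move=> gs /(is_germ_act gs)[]. Qed.

Lemma is_germ_eq g h s t x e : is_germ g s x -> is_germ h t x ->
  idempotents e -> pdom (act A e) x -> s * e = t * e -> g = h.
Proof.
by move=> gs ht eI De E; apply/(is_germ_eqP gs ht); split=> //; exists e.
Qed.

Lemma is_germ_inj g h s x : is_germ g s x -> is_germ h s x -> g = h.
Proof.
move=> gs hs; apply: (is_germ_eq gs hs (idempotent_starM s)) => //.
have := is_germ_dom gs; rewrite /pdom /=; case E : (act A s x) => [y|//] _.
by rewrite (act_mul_some E (proj1 (act_star _ _ _) E)).
Qed.

(** A germ may be represented by any [t] that agrees with [s] after an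
idempotent defined at the point. *)
Lemma is_germ_move g s t x e : is_germ g s x -> pdom (act A t) x ->
  idempotents e -> pdom (act A e) x -> s * e = t * e -> is_germ g t x.
Proof.
move=> gs Dt eI De E; have [h ht] := germ_ex Dt.
by rewrite (is_germ_eq gs ht eI De E).
Qed.

Lemma germP g : exists s x y, is_germ g s x /\ act A s x = Some y.
Proof.
have [s [x [Dx gs]]] := is_germ_ex g.
by move: Dx; rewrite /pdom /=; case E : (act A s x) => [y|//] _; exists s, x, y.
Qed.

Lemma idempotent_at x : exists2 e, idempotents e & pdom (act A e) x.
Proof.
have [s] := act_cover x; rewrite /pdom /=; case E : (act A s x) => [y|//] _.
exists (star s * s); first exact: idempotent_starM.
by rewrite (act_mul_some E (proj1 (act_star _ _ _) E)).
Qed.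

Lemma unit_germ_ex x : exists u : germ A, is_unit_germ u x.
Proof.
have [e eI De] := idempotent_at x; have [u ue] := germ_ex De.
by exists u; exists e.
Qed.

Lemma is_germ_unit u x e : is_unit_germ u x ->
  idempotents e -> pdom (act A e) x -> is_germ u e x.
Proof.
move=> [f fI uf] eI De; have Df := is_germ_dom uf.
apply: (is_germ_move uf De (idempotentM eI fI)).
  exact: pdom_mul_idempotent.
by rewrite mulgA (idempotentC fI eI) -mulgA fI mulgA eI.
Qed.

Lemma unit_germ_inj u v x : is_unit_germ u x -> is_unit_germ v x -> u = v.
Proof.
move=> [e eI ue] vx; apply: (is_germ_inj ue).
by apply: is_germ_unit => //; exact: is_germ_dom ue.
Qed.

Lemma unit_germ_src u x s y : is_unit_germ u x -> is_germ u s y -> x = y.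
Proof. by move=> [e _ ue]; exact: is_germ_src ue. Qed.

Lemma unit_germ_pt u x y : is_unit_germ u x -> is_unit_germ u y -> x = y.
Proof. by move=> ux [e _ ue]; exact: unit_germ_src ux ue. Qed.

Lemma is_germ_d g s x : is_germ g s x -> is_unit_germ (germ_d g) x.
Proof.
move=> gs; have [u ux] := unit_germ_ex x; rewrite /germ_d.
case: xgetP => [v _ [t [y [gt uy]]]|/(_ u)[]]; last by exists s, x.
by rewrite (is_germ_src gs gt).
Qed.

Lemma is_germ_r g s x y : is_germ g s x -> act A s x = Some y ->
  is_unit_germ (germ_r g) y.
Proof.
move=> gs sx; have [u uy] := unit_germ_ex y; rewrite /germ_r.
case: xgetP => [v _ [t [x' [y' [gt tx uy']]]]|/(_ u)[]]; last by exists s, x, y.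
by have [_] := is_germ_act gs gt; rewrite sx tx => -[->].
Qed.

Lemma is_germ_mul g h s t x y : is_germ g s x -> act A s x = Some y ->
  is_germ h t y -> is_germ (germ_mul h g) (t * s) x.
Proof.
move=> gs sx ht; have := is_germ_dom ht; rewrite /pdom /=.
case ty : (act A t y) => [z|//] _.
have Dts : pdom (act A (t * s)) x by rewrite /pdom /= (act_mul_some sx ty).
have [k kts] := germ_ex Dts; rewrite /germ_mul.
case: xgetP =>
  [k' _ [t' [s' [x' [y' [gs' sx' ht' kts']]]]]|/(_ k)[]]; last first.
  by exists t, s, x, y.
have [xE [e [eI De sE]]] := (is_germ_eqP gs gs').1 erefl; subst x'.
have [yE [f [fI Df tE]]] := (is_germ_eqP ht ht').1 erefl; subst y'.
(* [e2] transports [f], on which [t] and [t'] agree, to the source of [s]. *)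
have e2I := idempotent_conj s fI; set e2 := star s * f * s in e2I.
have De2 : pdom (act A e2) x.
  have sy := proj1 (act_star _ _ _) sx.
  rewrite /pdom /= (act_mul_some sx (_ : act A (star s * f) y = Some x)) //.
  by rewrite act_mul_idempotent.
apply: (is_germ_move kts' Dts (idempotentM e2I eI)).
  exact: pdom_mul_idempotent.
have -> : t * s * (e2 * e) = t' * s * (e2 * e).
  rewrite [LHS]mulgA [RHS]mulgA -(mulgA t) -(mulgA t') mulg_conj_idempotent //.
  by rewrite !mulgA tE.
by rewrite (idempotentC e2I eI) -!mulgA (mulgA s) (mulgA s') sE.
Qed.

Lemma is_germ_inv g s x y : is_germ g s x -> act A s x = Some y ->
  is_germ (germ_inv g) (star s) y.
Proof.
move=> gs sx; have sy := proj1 (act_star _ _ _) sx.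
have Dy : pdom (act A (star s)) y by rewrite /pdom /= sy.
have [k ks] := germ_ex Dy; rewrite /germ_inv.
case: xgetP => [k' _ [s' [x' [y' [gs' sx' ks']]]]|/(_ k)[]]; last first.
  by exists s, x, y.
have [xE [e [eI De sE]]] := (is_germ_eqP gs gs').1 erefl; subst x'.
have yE : y' = y by have [_] := is_germ_act gs gs'; rewrite sx sx' => -[].
subst y'.
have starE a : star a * ((a * e) * star (a * e)) = star (a * e).
  rewrite star_mul_idempotent // -!mulgA (mulgA e e) eI (mulgA (star a)).
  rewrite (mulgA _ e) (idempotentC _ eI); last exact: idempotent_starM.
  by rewrite -!mulgA (mulgA (star a)) (mulg_star a).2.
(* [star s] and [star s'] agree after the range idempotent of
   [s * e = s' * e]. *)
apply: (is_germ_move ks' Dy (e := (s * e) * star (s * e))).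
- by rewrite /idempotents /= mulgA (mulg_star (s * e)).1.
- have sex : act A (s * e) x = Some y by rewrite act_mul_idempotent.
  have := proj1 (act_star _ _ _) sex; rewrite /pdom /= => H.
  by rewrite (act_mul_some H sex).
- by transitivity (star (s * e)); [rewrite sE starE|rewrite starE].
Qed.

Let G := transformation_groupoid A.

Lemma composable_germs (h g : G) : gd h = gr g -> exists s t x y z,
  [/\ is_germ g s x, act A s x = Some y, is_germ h t y & act A t y = Some z].
Proof.
have [s [x [y [gs sx]]]] := germP g; have [t [y' [z [ht ty]]]] := germP h.
move=> hg; have := is_germ_d ht; rewrite [germ_d h]hg => hy.
have yE := unit_germ_pt hy (is_germ_r gs sx); subst y'.
by exists s, t, x, y, z.
Qed.

Lemma mul_germs (h g : G) s t x y z :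
  is_germ g s x -> act A s x = Some y -> is_germ h t y -> act A t y = Some z ->
  is_germ (gmul h g) (t * s) x /\ act A (t * s) x = Some z.
Proof.
by move=> gs sx ht ty; split; [exact: is_germ_mul sx ht|exact: act_mul_some ty].
Qed.

Lemma unit_germ_gd u x : is_unit_germ u x -> germ_d u = u /\ germ_r u = u.
Proof.
move=> ux; have [e eI ue] := ux; split.
  by apply: unit_germ_inj ux; exact: is_germ_d ue.
apply: unit_germ_inj ux.
exact: is_germ_r ue (act_idempotent eI (is_germ_dom ue)).
Qed.

Lemma transformation_is_groupoid : is_groupoid G.
Proof.
split.
- move=> g; have [s [x [_ [gs _]]]] := germP g.
  by exists x; exact: is_germ_d gs.
- move=> g; have [s [x [y [gs sx]]]] := germP g.
  by exists y; exact: is_germ_r gs sx.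
- by move=> u [x /unit_germ_gd[]].
- by move=> u [x /unit_germ_gd[]].
- move=> h g /composable_germs[s [t [x [y [z [gs sx ht ty]]]]]].
  have [ks _] := mul_germs gs sx ht ty.
  exact: unit_germ_inj (is_germ_d ks) (is_germ_d gs).
- move=> h g /composable_germs[s [t [x [y [z [gs sx ht ty]]]]]].
  have [ks kx] := mul_germs gs sx ht ty.
  exact: unit_germ_inj (is_germ_r ks kx) (is_germ_r ht ty).
- move=> k h g kh /composable_germs[s [t [x [y [z [gs sx ht ty]]]]]].
  have [r [y' [w [kr rw]]]] := germP k.
  have zE : y' = z.
    have := is_germ_d kr; rewrite [germ_d k]kh => ky.
    exact: unit_germ_pt ky (is_germ_r ht ty).
  subst y'.
  have [hgs hgx] := mul_germs gs sx ht ty.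
  have [khr khx] := mul_germs ht ty kr rw.
  have [k1 _] := mul_germs hgs hgx kr rw.
  have [k2 _] := mul_germs gs sx khr khx.
  by rewrite mulgA in k1; exact: is_germ_inj k1 k2.
- move=> g; have [s [x [y [gs sx]]]] := germP g.
  have [e eI De] := idempotent_at x.
  have ge := is_germ_unit (is_germ_d gs) eI De.
  have [ks _] := mul_germs ge (act_idempotent eI De) gs sx.
  by apply: (is_germ_eq ks gs eI De); rewrite -mulgA eI.
- move=> g; have [s [x [y [gs sx]]]] := germP g.
  have [e eI De] := idempotent_at y.
  have ge := is_germ_unit (is_germ_r gs sx) eI De.
  have [ks kx] := mul_germs gs sx ge (act_idempotent eI De).
  have sI := idempotent_conj s eI.
  have sy := proj1 (act_star _ _ _) sx.
  apply: (is_germ_eq ks gs sI).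
    by rewrite /pdom /= -mulgA (act_mul_some kx sy).
  by rewrite -mulgA mulg_conj_idempotent // mulgA eI.
- move=> g; have [s [x [y [gs sx]]]] := germP g.
  have vs := is_germ_inv gs sx.
  exact: unit_germ_inj (is_germ_d vs) (is_germ_r gs sx).
- move=> g; have [s [x [y [gs sx]]]] := germP g.
  have vs := is_germ_inv gs sx; have sy := proj1 (act_star _ _ _) sx.
  exact: unit_germ_inj (is_germ_r vs sy) (is_germ_d gs).
- move=> g; have [s [x [y [gs sx]]]] := germP g.
  have vs := is_germ_inv gs sx; have sy := proj1 (act_star _ _ _) sx.
  have [ks _] := mul_germs gs sx vs sy.
  apply: (unit_germ_inj _ (is_germ_d gs)).
  by exists (star s * s) => //; exact: idempotent_starM.
- move=> g; have [s [x [y [gs sx]]]] := germP g.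
  have vs := is_germ_inv gs sx; have sy := proj1 (act_star _ _ _) sx.
  have [ks _] := mul_germs vs sy gs sx.
  apply: (unit_germ_inj _ (is_germ_r gs sx)).
  by exists (s * star s) => //; rewrite /idempotents /= mulgA (mulg_star s).1.
Qed.

(** The sets [[s, U]] generate the topology; those with [s] fixed already form
a base of neighbourhoods of [[s, x]].  Indeed if [[s, x] = [t, x]], then [s]
and [t] agree after an idempotent [e], and [[s, y] = [t, y]] for all [y] in
the domain of [e], which is a neighbourhood of [x]. *)
Lemma nbhs_germE g s x W : is_germ g s x ->
  nbhs g W <-> nbhs x [set y | forall h, is_germ h s y -> W h].
Proof.
move=> gs; split.
  pose F := [set V : set (germ A) |
    nbhs x [set y | forall h, is_germ h s y -> V h]].
  have FF : Filter F.
    split.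
    - by rewrite /F /=; apply: (@filterS _ (nbhs x) _ setT) filterT => y _ h _.
    - rewrite /F /= => V1 V2 n1 n2.
      apply: (@filterS2 _ (nbhs x) _ _ _ _ _ n1 n2) => y H1 H2 h hs.
      by split; [exact: H1|exact: H2].
    - rewrite /F /= => V1 V2 sub n1.
      by apply: (@filterS _ (nbhs x) _ _ _ _ n1) => y H h /H /sub.
  suff subF V : nbhs g V -> F V by exact: subF.
  move=> [_ [[D' D'sub <-] [I D'I Ig] sub]].
  suff : F I by apply: filterS => h Ih; apply: sub; exists I.
  have [D Dsub IE] := D'sub _ D'I; rewrite -IE.
  apply: filter_bigI => J DJ; have := Dsub _ DJ.
  rewrite in_setE => -[t [U [oU Usub JE]]].
  have : J g by rewrite -IE in Ig; exact: Ig.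
  rewrite JE => -[x' Ux' gt]; have xE := is_germ_src gs gt; subst x'.
  have [_ [e [eI De E]]] := (is_germ_eqP gs gt).1 erefl.
  have nU : nbhs x U by exact: open_nbhs_nbhs.
  apply: filterS2 nU (nbhs_pdom De) => y Uy Dey h hs.
  exists y => //; exact: (is_germ_move hs (Usub _ Uy) eI Dey E).
move=> nV; set V := [set y | _] in nV.
have oO : open (germ_open s (V° `&` pdom (act A s))).
  exists [set germ_open s (V° `&` pdom (act A s))]; last exact: bigcup_set1.
  move=> _ ->; exists [fset germ_open s (V° `&` pdom (act A s))]%fset.
    move=> _ /fset1P ->; rewrite in_setE; exists s, (V° `&` pdom (act A s)).
    split=> //.
    by apply: openI; [exact: open_interior|have [] := act_pmap s].
  by rewrite set_fset1 bigcap_set1.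
have : nbhs g (germ_open s (V° `&` pdom (act A s))).
  apply: open_nbhs_nbhs; split=> //; exists x => //; split=> //.
  exact: is_germ_dom gs.
by apply: filterS => h [y [/interior_subset Vy _] hs]; exact: Vy.
Qed.

Lemma transformation_gd_continuous : continuous (@gd G).
Proof.
move=> g W; have [s [x [y [gs sx]]]] := germP g.
have [e eI De] := idempotent_at x; have du := is_germ_d gs.
move=> /(nbhs_germE _ (is_germ_unit du eI De)) nW; apply/(nbhs_germE _ gs).
apply: filterS2 nW (nbhs_pdom De) => z Wz Dz h hs; apply: Wz.
exact: is_germ_unit (is_germ_d hs) eI Dz.
Qed.

Lemma transformation_gr_continuous : continuous (@gr G).
Proof.
move=> g W; have [s [x [y [gs sx]]]] := germP g.
have [e eI De] := idempotent_at y; have du := is_germ_r gs sx.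
move=> /(nbhs_germE _ (is_germ_unit du eI De)) nW; apply/(nbhs_germE _ gs).
have := nbhs_ppre (act_pmap s) sx (nbhsI nW (nbhs_pdom De)).
apply: filterS => z [w sz [Ww Dw]] h hs; apply: Ww.
exact: is_germ_unit (is_germ_r hs sz) eI Dw.
Qed.

Lemma transformation_ginv_continuous : continuous (@ginv G).
Proof.
move=> g W; have [s [x [y [gs sx]]]] := germP g.
move=> /(nbhs_germE _ (is_germ_inv gs sx)) nW; apply/(nbhs_germE _ gs).
apply: filterS (nbhs_ppre (act_pmap s) sx nW) => z [w sz Ww] h hs.
by apply: Ww; exact: is_germ_inv hs sz.
Qed.

Lemma nbhs_germ_section g s x V : is_germ g s x -> nbhs x V ->
  nbhs g [set h | exists2 y, V y & is_germ h s y].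
Proof.
move=> gs nV; apply/(nbhs_germE _ gs).
by apply: filterS nV => y Vy h hs; exists y.
Qed.

Lemma transformation_gmul_continuous :
  {within @composable G, continuous (fun p : G * G => gmul p.1 p.2)}.
Proof.
apply/gmul_continuousP => h g W.
move=> /composable_germs[s [t [x [y [z [gs sx ht ty]]]]]].
have [ks _] := mul_germs gs sx ht ty; move=> /(nbhs_germE _ ks) nV.
exists [set h | exists2 y, setT y & is_germ h t y].
exists [set g | exists2 x, [set x' | forall k, is_germ k (t * s) x' -> W k] x &
  is_germ g s x]; split.
- by apply: nbhs_germ_section ht _; exact: filterT.
- exact: nbhs_germ_section gs nV.
move=> h' g' [y' _ ht'] [x' Wx' gs'] /composable_germs.
move=> [s1 [t1 [x1 [y1 [z1 [gs1 sx1 ht1 ty1]]]]]].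
have [? E] := is_germ_act gs' gs1; have [? E'] := is_germ_act ht' ht1; subst.
rewrite -E in sx1; rewrite -E' in ty1.
by apply: Wx'; have [] := mul_germs gs' sx1 ht' ty1.
Qed.

Lemma transformation_etale : is_etale G.
Proof.
split.
- exact: transformation_is_groupoid.
- exact: transformation_gd_continuous.
- exact: transformation_gr_continuous.
- exact: transformation_ginv_continuous.
- exact: transformation_gmul_continuous.
apply: local_homeo_gd.
- exact: transformation_is_groupoid.
- exact: transformation_gd_continuous.
- move=> g; have [s [x [y [gs sx]]]] := germP g.
  exists [set h | exists2 y, setT y & is_germ h s y].
    by apply: nbhs_germ_section gs _; exact: filterT.
  move=> h k; rewrite !in_setE => -[a _ hs] [b _ ks] E.
  have := is_germ_d hs; rewrite [germ_d h]E => u.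
  have ab := unit_germ_pt u (is_germ_d ks); subst b.
  exact: is_germ_inj hs ks.
- move=> g W; have [s [x [y [gs sx]]]] := germP g => /(nbhs_germE _ gs) nW.
  have [e eI De] := idempotent_at x.
  have du := is_germ_unit (is_germ_d gs) eI De.
  apply/(nbhs_germE _ du); apply: filterS2 nW (nbhs_pdom (is_germ_dom gs)).
  move=> z Wz Dz u ue; have [h hs] := germ_ex Dz; exists h; first exact: Wz.
  apply: unit_germ_inj (is_germ_d hs) _; exists e => //.
Qed.

End germs.

(** * The functor on morphisms *)

Lemma lcH_homeo (X T : topologicalType) (f : T -> X) (g : X -> T) :
  continuous f -> continuous g -> cancel f g -> cancel g f -> lcH X -> lcH T.
Proof.
move=> fc gc fK gK [lX hX].
have hT : hausdorff_space T.
  move=> p q pq; apply: (can_inj fK); apply: hX => U V nU nV.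
  have [t [Ut Vt]] := pq _ _ (nbhs_comp fc nU) (nbhs_comp fc nV).
  by exists (f t).
split=> // t _; have [|U nU [cU _]] := lX (f t) _; first by [].
have cgU : compact (g @` U).
  by apply: continuous_compact cU; exact: continuous_subspaceT.
exists (g @` U); last by split=> //; exact: compact_closed.
have nfU : nbhs (f t) U.
  by move: nU; rewrite /within /=; apply: filterS => x /(_ I).
by apply: filterS (nbhs_comp fc nfU) => s Us _; exists (f s).
Qed.

Section germ_point.
Variable A : action.
Let G := transformation_groupoid A.

Lemma germ_pt_ex (g : germ A) : exists x, exists s, is_germ g s x.
Proof. by have [s [x [y [gs _]]]] := germP g; exists x, s. Qed.

Definition germ_pt (g : germ A) : asp A := projT1 (cid (germ_pt_ex g)).

Lemma germ_ptE g s x : is_germ g s x -> germ_pt g = x.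
Proof.
move=> gs; rewrite /germ_pt; case: cid => y [t gt] /=.
exact: is_germ_src gt gs.
Qed.

Definition unit_germ (x : asp A) : germ A := projT1 (cid (unit_germ_ex x)).

Lemma unit_germE x : is_unit_germ (unit_germ x) x.
Proof. by rewrite /unit_germ; case: cid. Qed.

Lemma germ_pt_unit u x : is_unit_germ u x -> germ_pt u = x.
Proof. by move=> [e _ /germ_ptE]. Qed.

Lemma unit_germK u : gunit G u -> unit_germ (germ_pt u) = u.
Proof.
move=> [x ux]; rewrite (germ_pt_unit ux).
exact: unit_germ_inj (unit_germE x) ux.
Qed.

Lemma germ_pt_continuous : continuous germ_pt.
Proof.
move=> g W; have [s [x [y [gs _]]]] := germP g.
rewrite (germ_ptE gs) => nW; apply/(nbhs_germE _ gs).
by apply: filterS nW => z Wz h hs; rewrite /= (germ_ptE hs).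
Qed.

Lemma unit_germ_continuous : continuous unit_germ.
Proof.
move=> x W; have [e eI De] := idempotent_at x.
have ue := is_germ_unit (unit_germE x) eI De.
move=> /(nbhs_germE _ ue) nW; apply: filterS2 nW (nbhs_pdom De) => z Wz Dz.
by apply: Wz; exact: is_germ_unit (unit_germE z) eI Dz.
Qed.

(** The unit space is homeomorphic to the space acted upon, by
[unit_germ]. *)
Lemma transformation_lcH : lcH (asp A) -> lcH (set_type (gunit G)).
Proof.
have uG x : unit_germ x \in gunit G.
  by rewrite in_setE; exists x; exact: unit_germE.
pose f (u : set_type (gunit G)) := germ_pt (val u).
pose g x : set_type (gunit G) := exist _ (unit_germ x) (uG x).
apply: (@lcH_homeo _ _ f g).
- have vc : continuous (val : set_type (gunit G) -> G).
    exact: initial_continuous.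
  by move=> u W nW; exact: nbhs_comp vc (nbhs_comp germ_pt_continuous nW).
- apply: continuous_comp_initial; exact: unit_germ_continuous.
- by move=> u; apply: val_inj; apply: unit_germK; exact: (set_mem (valP u)).
- by move=> x; rewrite /f /= (germ_pt_unit (unit_germE x)).
Qed.

End germ_point.

Section TG_couple.
Variables (A B : action) (f : action_mor A B).
Let K : action := action_res f.
Implicit Types (y z : asp K).

Lemma xi_some y : exists x, xi f (val y) = Some x.
Proof.
have := set_mem (valP y); rewrite /pdom /=.
by case: (xi f (val y)) => [x|//] _; exists x.
Qed.

Lemma pdom_res s y : pdom (act K s) y <-> pdom (act B (theta f s)) (val y).
Proof.
rewrite /pdom /=; split.
  by case E : (@res_act _ _ f s y) => [z|//] _; move/res_actE: E => ->.
case E : (act B (theta f s) (val y)) => [z|//] _.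
by have [w _ ->] := res_act_some E.
Qed.

Lemma pdom_xi s y x : xi f (val y) = Some x ->
  pdom (act K s) y <-> pdom (act A s) x.
Proof.
move=> xiy; rewrite pdom_res -xi_dom; split=> [[x']|Dx]; last by exists x.
by rewrite xiy => -[<-].
Qed.

Lemma xi_act s x y z : xi f (val y) = Some x -> act K s y = Some z ->
  exists2 w, xi f (val z) = Some w & act A s x = Some w.
Proof.
move=> xiy sy; have Dy : pdom (act K s) y by rewrite /pdom /= [res_act _ _]sy.
have /xi_equiv : ppre (xi f) (pdom (act A s)) (val y).
  by exists x => //; apply/(pdom_xi s xiy).
move/res_actE: sy => sy; rewrite /pcomp xiy sy /= => ->.
by have [w zw] := xi_some z; exists w.
Qed.

Lemma theta_idempotent e : idempotents e -> idempotents (theta f e).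
Proof. by rewrite /idempotents /= -gmulfM => ->. Qed.

Lemma TG_phiE g s y x : is_germ (A := K) g s y -> xi f (val y) = Some x ->
  is_germ (TG_phi g) s x.
Proof.
move=> gs xiy; rewrite /TG_phi; case: cid => h /= [s' [y' [x' [gs' xiy' hs]]]].
have [yE [e [eI De E]]] := (is_germ_eqP gs gs').1 erefl; subst y'.
move: xiy'; rewrite xiy => -[?]; subst x'.
apply: (is_germ_move hs _ eI _ (esym E)).
  exact/(pdom_xi _ xiy)/(is_germ_dom gs).
exact/(pdom_xi _ xiy).
Qed.

Lemma TG_psiE g s y : is_germ (A := K) g s y ->
  is_germ (TG_psi g) (theta f s) (val y).
Proof.
move=> gs; rewrite /TG_psi; case: cid => h /= [s' [y' [gs' hs]]].
have [yE [e [eI De E]]] := (is_germ_eqP gs gs').1 erefl; subst y'.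
apply: (is_germ_move hs _ (theta_idempotent eI)).
- exact/pdom_res/(is_germ_dom gs).
- exact/pdom_res.
- by rewrite -!gmulfM E.
Qed.

Lemma TG_phi_unit u y x : is_unit_germ (A := K) u y -> xi f (val y) = Some x ->
  is_unit_germ (TG_phi u) x.
Proof. by move=> [e eI ue] xiy; exists e => //; exact: TG_phiE ue xiy. Qed.

Lemma TG_psi_unit u y : is_unit_germ (A := K) u y ->
  is_unit_germ (TG_psi u) (val y).
Proof.
move=> [e eI ue]; exists (theta f e); first exact: theta_idempotent.
exact: TG_psiE.
Qed.

Let GK := transformation_groupoid K.

Lemma TG_phi_ghom : @is_ghom GK (transformation_groupoid A) (@TG_phi _ _ f).
Proof.
split.
- move=> u [y uy]; have [x xiy] := xi_some y.
  by exists x; exact: TG_phi_unit uy xiy.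
- move=> g; have [s [y [z [gs sy]]]] := germP g; have [x xiy] := xi_some y.
  apply: unit_germ_inj (TG_phi_unit (is_germ_d gs) xiy) _.
  exact: is_germ_d (TG_phiE gs xiy).
- move=> g; have [s [y [z [gs sy]]]] := germP g; have [x xiy] := xi_some y.
  have [w xiz sx] := xi_act xiy sy.
  apply: unit_germ_inj (TG_phi_unit (is_germ_r gs sy) xiz) _.
  exact: is_germ_r (TG_phiE gs xiy) sx.
- move=> h g /composable_germs[s [t [y [z [z' [gs sy ht tz]]]]]].
  have [x xiy] := xi_some y; have [w xiz sx] := xi_act xiy sy.
  have [ks _] := mul_germs gs sy ht tz.
  apply: is_germ_inj (TG_phiE ks xiy) _.
  exact: is_germ_mul (TG_phiE gs xiy) sx (TG_phiE ht xiz).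
Qed.

Lemma TG_psi_ghom : @is_ghom GK (transformation_groupoid B) (@TG_psi _ _ f).
Proof.
split.
- by move=> u [y uy]; exists (val y); exact: TG_psi_unit.
- move=> g; have [s [y [z [gs sy]]]] := germP g.
  apply: unit_germ_inj (TG_psi_unit (is_germ_d gs)) _.
  exact: is_germ_d (TG_psiE gs).
- move=> g; have [s [y [z [gs sy]]]] := germP g.
  apply: unit_germ_inj (TG_psi_unit (is_germ_r gs sy)) _.
  by apply: is_germ_r (TG_psiE gs) _; exact/res_actE.
- move=> h g /composable_germs[s [t [y [z [z' [gs sy ht tz]]]]]].
  have [ks _] := mul_germs gs sy ht tz.
  apply: is_germ_inj (TG_psiE ks) _; rewrite gmulfM.
  by apply: is_germ_mul (TG_psiE gs) _ (TG_psiE ht); exact/res_actE.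
Qed.

Lemma val_continuous : continuous (val : asp K -> asp B).
Proof. exact: initial_continuous. Qed.

Lemma TG_phi_continuous :
  continuous (@TG_phi _ _ f : GK -> transformation_groupoid A).
Proof.
move=> g W; have [s [y [z [gs sy]]]] := germP g; have [x xiy] := xi_some y.
move=> /(nbhs_germE _ (TG_phiE gs xiy)) nW; apply/(nbhs_germE _ gs).
have := nbhs_comp val_continuous (nbhs_ppre (xi_pmap f) xiy nW).
by apply: filterS => y' [x' xiy' Wx'] h hs; apply: Wx'; exact: TG_phiE hs xiy'.
Qed.

Lemma TG_psi_continuous :
  continuous (@TG_psi _ _ f : GK -> transformation_groupoid B).
Proof.
move=> g W; have [s [y [z [gs sy]]]] := germP g.
move=> /(nbhs_germE _ (TG_psiE gs)) nW; apply/(nbhs_germE _ gs).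
apply: filterS (nbhs_comp val_continuous nW) => y' Wy' h hs.
by apply: Wy'; exact: TG_psiE.
Qed.

(** The domain of [xi] is open. *)
Lemma nbhs_val_image y V : nbhs y V -> nbhs (val y) (val @` V).
Proof.
move=> [_ [[O oO <-] Oy] OV].
have nO : nbhs (val y) O by exact: open_nbhs_nbhs.
have nD : nbhs (val y) (pdom (xi f)).
  apply: open_nbhs_nbhs; split; last exact: (set_mem (valP y)).
  by have [] := xi_pmap f.
apply: filterS2 nO nD => z Oz Dz.
by exists (exist _ z (mem_set Dz)) => //; apply: OV.
Qed.

Lemma TG_couple_is_couple : is_couple (TG_couple f).
Proof.
split.
- exact: transformation_etale.
- exact: TG_phi_ghom.
- exact: TG_phi_continuous.
- move=> u [y uy]; have [x xiy] := xi_some y.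
  have fibreE g : gfibre (u : GK) g -> exists s, is_germ g s y.
    have [s [y' [z [gs sy]]]] := germP g; rewrite /gfibre /= => gu.
    have := is_germ_d gs; rewrite [germ_d g]gu => uy'.
    by exists s; rewrite (unit_germ_pt uy uy').
  split.
  + by move=> g <-; exact: esym (ghom_d TG_phi_ghom g).
  + move=> g h; rewrite !in_setE => /fibreE[s gs] /fibreE[t ht] E.
    have [_ [e [eI De sE]]] :=
      (is_germ_eqP (TG_phiE gs xiy) (TG_phiE ht xiy)).1 E.
    by apply: (is_germ_eq gs ht eI _ sE); exact/(pdom_xi _ xiy).
  + move=> h; rewrite /gfibre /= => hu; have [s [x' [z [hs sx]]]] := germP h.
    have := is_germ_d hs; rewrite [germ_d h]hu => ux'.
    have xE := unit_germ_pt ux' (TG_phi_unit uy xiy); subst x'.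
    have [g gs] : exists g, is_germ (A := K) g s y.
      by apply: germ_ex; exact/(pdom_xi _ xiy)/(is_germ_dom hs).
    exists g; first exact: unit_germ_inj (is_germ_d gs) uy.
    exact: is_germ_inj (TG_phiE gs xiy) hs.
- exact: TG_psi_ghom.
- exact: TG_psi_continuous.
- move=> u v; rewrite !in_setE => -[y uy] [z vz] E.
  have := TG_psi_unit uy; rewrite [TG_psi u]E => vy.
  have yz : y = z by apply: val_inj; exact: unit_germ_pt vy (TG_psi_unit vz).
  by subst z; exact: unit_germ_inj uy vz.
- apply: couple_psi_openI; first exact: TG_psi_ghom.
  move=> u W [y [e eI ue]] /(nbhs_germE _ ue) nW.
  apply/(nbhs_germE _ (TG_psiE ue)).
  apply: filterS (nbhs_val_image (nbhsI nW (nbhs_pdom (is_germ_dom ue)))).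
  move=> _ [y' [Wy' Dy'] <-] k ke; have [h he] := germ_ex Dy'.
  exists h; last exact: is_germ_inj (TG_psiE he) ke.
  by split; [exact: Wy'|exists y', e].
Qed.

(** The base points of the units over [C] lie in the preimage by [xi] of the
compact set of base points of [C]; a cluster point there is in the domain of
[xi], and the unit over it is a cluster point of the given filter. *)
Lemma TG_couple_proper : proper_pmap (xi f) -> proper_couple (TG_couple f).
Proof.
move=> xip C CG Cc F FF FS.
have C'c : compact (@germ_pt A @` C).
  apply: continuous_compact Cc; apply: continuous_subspaceT.
  exact: germ_pt_continuous.
pose p (u : germ K) : asp B := val (germ_pt u).
have SE u : (gunit GK `&` @TG_phi _ _ f @^-1` C) u ->
    ppre (xi f) (@germ_pt A @` C) (p u).
  move=> [[y uy] Cu]; have [x xiy] := xi_some y.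
  rewrite /p (germ_pt_unit uy); exists x => //; exists (TG_phi u) => //.
  exact: germ_pt_unit (TG_phi_unit uy xiy).
have FC : F (p @^-1` ppre (xi f) (@germ_pt A @` C)) by apply: filterS FS.
have [y0 [[x xiy [c Cc' cx]] cly]] := xip _ C'c (p @ F) _ FC.
have Dy : y0 \in pdom (xi f) by rewrite in_setE /pdom /= xiy.
pose y : asp K := exist _ y0 Dy.
have [e eI De] := idempotent_at y.
have ux := unit_germE y; set u := unit_germ y in ux.
have ue := is_germ_unit ux eI De.
exists u; split.
  split; first by exists y.
  rewrite /= (_ : TG_phi u = c) //.
  have [x' cx'] := CG _ Cc'.
  have := germ_pt_unit cx'; rewrite cx => xE; subst x'.
  exact: unit_germ_inj (TG_phi_unit ux xiy) cx'.
move=> E W FE /(nbhs_germE _ ue) nW.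
pose E' := E `&` gunit GK.
have FE' : F (p @^-1` (p @` E')).
  apply: filterS2 FE FS => q Eq [qK _]; exact: (imageP _ (conj Eq qK : E' q)).
have nV : nbhs y0 _ := nbhs_val_image (nbhsI nW (nbhs_pdom De)).
have [_ [[q [Eq [z qz]] <-] [z' [Wz Dz] zE]]] := cly _ _ FE' nV.
exists q; split=> //; apply: Wz; apply: is_germ_unit => //.
by move: zE; rewrite /p (germ_pt_unit qz) => /val_inj ->.
Qed.

Lemma TG_couple_graph g h : couple_graph (TG_couple f) g h <->
  exists s (b : asp B) x,
    [/\ xi f b = Some x, is_germ g s x & is_germ h (theta f s) b].
Proof.
split.
  move=> [k <- <-]; have [s [y [z [ks sy]]]] := germP k.
  have [x xiy] := xi_some y; exists s, (val y), x.
  by split=> //; [exact: TG_phiE ks xiy|exact: TG_psiE].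
move=> [s [y0 [x [xiy gs hs]]]].
have Dy : y0 \in pdom (xi f) by rewrite in_setE /pdom /= xiy.
pose y : asp K := exist _ y0 Dy.
have [k ks] : exists k, is_germ (A := K) k s y.
  by apply: germ_ex; apply/pdom_res; exact: is_germ_dom hs.
exists k; first exact: is_germ_inj (TG_phiE ks xiy) gs.
exact: is_germ_inj (TG_psiE ks) hs.
Qed.

End TG_couple.

(** * Categories of actions and functoriality *)

Lemma action_category (P : category_class action_data) :
  (forall A, in_ob P A -> in_hom P (action_id A)) ->
  (forall A B C (g : action_mor B C) (f : action_mor A B),
     in_hom P g -> in_hom P f -> in_hom P (action_comp g f)) ->
  is_category P.
Proof.
move=> Pid Pcomp; split.
- by move=> A PA; split=> //; exact: Pid.
- by move=> A B C g f [PB PC Pg] [PA _ Pf]; split=> //; exact: Pcomp.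
- by [].
- by move=> A B f f' _ _ [tE xE]; split.
- by move=> A B f f' f'' _ _ _ [tE xE] [tE' xE']; split=> x; rewrite ?tE ?xE.
- move=> A B C g g' f f' _ _ _ _ [gt gx] [ft fx]; split=> x /=.
    by rewrite ft gt.
  by rewrite /pcomp gx; case: (xi g' x) => //= y; rewrite fx.
- by move=> A B f _; split=> x //=; rewrite /pcomp /=; case: (xi f x).
- by move=> A B f _; split=> x //=; rewrite /pcomp /=; case: (xi f x).
- move=> A B C D h g f _ _ _; split=> x //=.
  by rewrite /pcomp /=; case: (xi h x).
Qed.

Lemma ISA_category : is_category ISA.
Proof. exact: action_category. Qed.

Lemma ISA_lcH_category : is_category ISA_lcH.
Proof.
apply: action_category; first by move=> A _ C Cc; rewrite ppre_some.
by move=> A B C g f pg pf V Vc; rewrite ppre_comp; apply: pg; exact: pf.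
Qed.

Lemma EG_category : is_category EG.
Proof.
apply: groupoid_category => //; first exact: couple_id_is_couple.
by move=> G1 G2 G3 c2 c1 [e2 e3 cc2] [e1 _ cc1]; exact: couple_comp_is_couple.
Qed.

Lemma EG_lcH_category : is_category EG_lcH.
Proof.
apply: groupoid_category => //.
- by move=> G [].
- by move=> G H c [].
- move=> G [eG _]; split; first exact: couple_id_is_couple.
  exact: couple_id_proper.
- move=> G1 G2 G3 c2 c1 [[e2 _] [e3 _] [cc2 p2]] [[e1 _] _ [cc1 p1]].
  by split; [exact: couple_comp_is_couple|exact: couple_comp_proper].
Qed.

(** By [couple_eqP] all the equations are between graphs.  For composition,
[[theta s, y] = [t, xi z]] means that [theta s] and [t] agree after an
idempotent [e], and then their images under a second morphism agree after the
image of [e], which is defined at [z]. *)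
Lemma TG_functor (P : category_class action_data)
    (Q : category_class groupoid_data) :
  (forall G, in_ob Q G -> is_etale G) ->
  (forall A, in_ob P A -> in_ob Q (transformation_groupoid A)) ->
  (forall A B (f : action_mor A B),
     arrow (C := action_data) P f -> in_hom Q (TG_couple f)) ->
  is_functor P Q TG.
Proof.
move=> Qob obin homin.
have eT A := transformation_etale A.
have cT := TG_couple_is_couple.
split=> //=.
- move=> A B f af.
  by split; [have [/obin] := af|have [_ /obin] := af|exact: homin].
- move=> A B f f' _ _ [tE xE]; apply/couple_eqP => // g h.
  split=> /TG_couple_graph[s [y [x [xy gs hs]]]]; apply/TG_couple_graph;
    exists s, y, x; by rewrite ?xE ?tE // -xE -tE.
- move=> A _; apply/couple_eqP => //; first exact: couple_id_is_couple.
  move=> g h; split.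
    move=> /TG_couple_graph[s [y [x [[<-] gs hs]]]].
    by apply/couple_id_graph; exact: is_germ_inj gs hs.
  move=> /couple_id_graph ->; apply/TG_couple_graph.
  by have [s [x [y [hs _]]]] := germP h; exists s, x, x.
- move=> A B C g f _ _; apply/couple_eqP => //.
    exact: couple_comp_is_couple.
  move=> k m; split.
    move=> /TG_couple_graph[s [z [x []]]]; rewrite /= /pcomp.
    case gz : (xi g z) => [y|//] /= fy ks ms.
    have [l ls] : exists l, is_germ l (theta f s) y.
      apply: germ_ex; have := is_germ_dom ms; rewrite -xi_dom => -[y'].
      by rewrite gz => -[->].
    apply/couple_comp_graph; exists l; apply/TG_couple_graph.
      by exists s, y, x.
    by exists (theta f s), z, y.
  move=> /couple_comp_graph[l /TG_couple_graph[s [y [x [fy ks ls]]]]].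
  move=> /TG_couple_graph[t [z [y' [gz lt mt]]]].
  have [yE [e [eI De E]]] := (is_germ_eqP ls lt).1 erefl; subst y'.
  apply/TG_couple_graph; exists s, z, x; split=> //.
    by rewrite /= /pcomp gz.
  have gdom r : pdom (act B r) y -> pdom (act C (theta g r)) z.
    by move=> Dr; rewrite -xi_dom; exists y.
  apply: (is_germ_move mt _ (theta_idempotent g eI)).
  - exact/gdom/(is_germ_dom ls).
  - exact: gdom.
  - by rewrite /= -!gmulfM E.
Qed.

Theorem corollary5p3 :
  [/\ is_functor ISA EG TG,
      is_subcategory ISA_lcH ISA,
      is_subcategory EG_lcH EG &
      is_functor ISA_lcH EG_lcH TG].
Proof.
split.
- apply: TG_functor => //; first by move=> A _; exact: transformation_etale.
  by move=> A B f _; exact: TG_couple_is_couple.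
- by split=> //; [exact: ISA_lcH_category|exact: ISA_category].
- split; [exact: EG_lcH_category|exact: EG_category|by move=> G []|].
  by move=> G H c [[eG _] [eH _] []].
- apply: TG_functor; first by move=> G [].
    move=> A lA; split; first exact: transformation_etale.
    exact: transformation_lcH.
  move=> A B f [_ _ pf].
  by split; [exact: TG_couple_is_couple|exact: TG_couple_proper].
Qed.
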